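(* Let $\mathcal S$ be a smooth surface (2-dimensional manifold) and let $\hat F, \check F$ be projectively equivalent Finsler metrics on $\mathcal S$. In local coordinates $(x^1,x^2,\xi^1,\xi^2)$ on $T\mathcal S$ induced by local coordinates $(x^1,x^2)$ on $\mathcal S$, define $$I(x,\xi) := \frac{\hat F_{\xi^1\xi^1}(x,\xi) + \hat F_{\xi^2\xi^2}(x,\xi)}{\check F_{\xi^1\xi^1}(x,\xi) + \check F_{\xi^2\xi^2}(x,\xi)}, \qquad (x,\xi)\in T\mathcal S\backslash 0,$$ which is the factor of proportionality of the fiber-Hessians, i.e. $\hat F_{\xi^i\xi^j}(x,\xi) = I(x,\xi)\, \check F_{\xi^i\xi^j}(x,\xi)$ for all $i,j\in\{1,2\}$. Then $I$ is independent of the choice of local coordinates, so that it is a well-defined function $I: T\mathcal S\backslash 0\to\mathbb R$, and $I$ is an integral for the geodesic flow of both metrics, i.e. $I$ is constant along the integral curves of the geodesic spray of $\hat F$ and along the integral curves of the geodesic spray of $\check F$.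
   Context: Let $M$ be a smooth manifold, $TM\backslash 0$ its tangent bundle with the zero section removed, and $(x,\xi)$ local coordinates on $TM$ induced by local coordinates $x$ on $M$. Subscripts such as $F_{x^i}$, $F_{\xi^i}$, $F_{\xi^i\xi^j}$ denote partial derivatives. A Finsler metric on $M$ is a function $F: TM \to \mathbb R_{\geq 0}$ such that (i) $F(x,\lambda\xi) = \lambda F(x,\xi)$ for all $\lambda > 0$; (ii) $F|_{TM\backslash 0}$ is smooth and the matrix $g_{ij}|_{(x,\xi)} := \tfrac12 \frac{\partial^2 F^2}{\partial \xi^i \partial \xi^j}(x,\xi)$ is positive definite for all $(x,\xi)\in TM\backslash 0$. The metric is not assumed reversible. The geodesics of $F$ are the (regular) curves $c$ in $M$ solving the Euler-Lagrange equation $L_{x^i} - \frac{d}{dt}(L_{\xi^i}) = 0$ along $(c,\dot c)$, for the Lagrangian $L = \tfrac12 F^2$. The geodesic spray of $F$ is the globally defined vector field $S$ on $TM\backslash 0$ whose integral curves projected to $M$ are exactly the geodesics (the integral curves being $t\mapsto (c(t),\dot c(t))$ for geodesics $c$); in local coordinates $S = \xi^i\partial_{x^i} - 2G^i(x,\xi)\partial_{\xi^i}$. The geodesic flow is the (local) flow of $S$. Two Finsler metrics $\hat F,\check F$ on $M$ are projectively equivalent if any geodesic of $\hat F$ is a geodesic of $\check F$ after an orientation-preserving reparametrization. *)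

(* Defs.v *)
From HB Require Import structures.
From mathcomp Require Import all_boot all_order all_algebra.
From mathcomp Require Import all_classical all_reals all_analysis.

Set Implicit Arguments.
Unset Strict Implicit.
Unset Printing Implicit Defensive.

Import Order.TTheory GRing.Theory Num.Theory.
Import numFieldNormedType.Exports.

Local Open Scope ring_scope.
Local Open Scope classical_set_scope.

Section Smoothness.
Variable R : realType.

(* For open U and finite-dimensional V and W this is the class C^k(U, W);
   the values of f outside U are irrelevant. *)
Fixpoint Ck_on (k : nat) (V W : normedModType R) (U : set V) (f : V -> W) :
    Prop :=
  if k is k'.+1 then
    (forall x, U x -> differentiable f x) /\ (forall v, Ck_on k' U ('D_v f))
  else forall x, U x -> {for x, continuous f}.

Definition smooth_on (V W : normedModType R) (U : set V) (f : V -> W) : Prop :=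
  forall k, Ck_on k U f.

Definition open_interval (J : set R) : Prop := open J /\ is_interval J.

End Smoothness.

Section Manifold.
Variables (R : realType) (n : nat).

(* cmap and cinv are total functions; only their restrictions to cdom and to
   cmap @` cdom are meaningful. *)
Record chart (M : topologicalType) : Type := Chart {
  cdom : set M;
  cmap : M -> 'rV[R]_n;
  cinv : 'rV[R]_n -> M;
  cdom_open : open cdom;
  cimg_open : open (cmap @` cdom);
  cmapK : forall p, cdom p -> cinv (cmap p) = p;
  cmap_continuous : forall p, cdom p -> {for p, continuous cmap};
  cinv_continuous : forall x, (cmap @` cdom) x -> {for x, continuous cinv} }.

Definition cimg (M : topologicalType) (phi : chart M) : set 'rV[R]_n :=
  cmap phi @` cdom phi.

Definition transition (M : topologicalType) (phi psi : chart M) :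
    'rV[R]_n -> 'rV[R]_n :=
  cmap psi \o cinv phi.

Definition compatible (M : topologicalType) (phi psi : chart M) : Prop :=
  smooth_on (cmap phi @` (cdom phi `&` cdom psi)) (transition phi psi) /\
  smooth_on (cmap psi @` (cdom phi `&` cdom psi)) (transition psi phi).

(* The atlas is maximal, so its elements are all the local coordinate systems. *)
Record manifold : Type := Manifold {
  carrier :> topologicalType;
  carrier_hausdorff : hausdorff_space carrier;
  carrier_countable : @second_countable carrier;
  atlas : set (chart carrier);
  atlas_cover : forall p : carrier, exists2 phi, atlas phi & cdom phi p;
  atlas_compatible : forall phi psi, atlas phi -> atlas psi ->
    compatible phi psi;
  atlas_maximal : forall phi, (forall psi, atlas psi -> compatible phi psi) ->
    atlas phi }.

End Manifold.

Section TangentBundle.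
Variables (R : realType) (n : nat) (M : manifold R n).
Implicit Types (phi psi : chart R n M) (p : M).

Definition chart_at p phi : Prop := atlas phi /\ cdom phi p.

(* A tangent vector at tbase is given by its components in all charts around
   tbase, subject to the usual transformation law; the components in the other
   charts are set to 0 so that equality is the right one. *)
Record tangent : Type := Tangent {
  tbase : M;
  tcomp : chart R n M -> 'rV[R]_n;
  tcomp_law : forall phi psi, chart_at tbase phi -> chart_at tbase psi ->
    tcomp psi = 'd (transition phi psi) (cmap phi tbase) (tcomp phi);
  tcomp_out : forall phi, ~ chart_at tbase phi -> tcomp phi = 0 }.

Lemma tangent_eq (u v : tangent) :
  tbase u = tbase v -> tcomp u = tcomp v -> u = v.
Proof.
case: u => p a la oa; case: v => q b lb ob /= pq ab.
by move: la oa lb ob; rewrite pq ab => *; congr Tangent; exact: Prop_irrelevance.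
Qed.

Lemma cdom_nbhs phi psi p : cdom phi p -> cdom psi p ->
  \forall x \near cmap phi p, cimg phi x /\ cdom psi (cinv phi x).
Proof.
move=> php psp.
have ip : cimg phi (cmap phi p) by exists p.
have io : nbhs (cmap phi p) (cimg phi).
  by apply: open_nbhs_nbhs; split => //; exact: cimg_open.
have /(_ (cdom psi)) := cinv_continuous ip.
rewrite cmapK// => /(_ (open_nbhs_nbhs (conj (cdom_open psi) psp))) pn.
by near=> x; split; near: x.
Unshelve. all: by end_near. Qed.

Lemma transition_differentiable p phi psi : chart_at p phi -> chart_at p psi ->
  differentiable (transition phi psi) (cmap phi p).
Proof.
move=> [aph php] [aps psp]; have [/(_ 1%N)[+ _] _] := atlas_compatible aph aps.
by apply; exists p.
Qed.

Lemma transition_diff_comp p phi psi psi' v :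
  chart_at p phi -> chart_at p psi -> chart_at p psi' ->
  'd (transition phi psi') (cmap phi p) v =
  'd (transition psi psi') (cmap psi p) ('d (transition phi psi) (cmap phi p) v).
Proof.
move=> hphi hpsi hpsi'.
have tp : transition phi psi (cmap phi p) = cmap psi p.
  by rewrite /transition /= cmapK//; case: hphi.
have d1 := transition_differentiable hphi hpsi.
have d2 := transition_differentiable hpsi hpsi'.
have d3 := transition_differentiable hphi hpsi'.
rewrite -tp in d2 *.
have e := diff_comp d1 d2.
have d4 := differentiable_comp d1 d2.
transitivity ('D_v (transition psi psi' \o transition phi psi) (cmap phi p)).
  rewrite -(deriveE v d3).
  apply: near_eq_derive; near=> x.
  rewrite /transition /= cmapK//.
  suff [] : cimg phi x /\ cdom psi (cinv phi x) by [].
  by near: x; apply: cdom_nbhs; [case: hphi|case: hpsi].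
rewrite (deriveE v d4).
exact (congr1 (fun f : 'rV[R]_n -> 'rV[R]_n => f v) e).
Unshelve. all: by end_near. Qed.

Lemma transition_diff_id p phi v : chart_at p phi ->
  'd (transition phi phi) (cmap phi p) v = v.
Proof.
move=> hphi; have d := transition_differentiable hphi hphi.
rewrite -deriveE// (@near_eq_derive _ _ _ _ id) ?derive_id//.
have php : cdom phi p by case: hphi.
near=> x.
have [[q hq <-] _] : cimg phi x /\ cdom phi (cinv phi x).
  by near: x; exact: cdom_nbhs.
by rewrite /transition /= cmapK.
Unshelve. all: by end_near. Qed.

Definition tangent_comp p phi (xi : 'rV[R]_n) (psi : chart R n M) : 'rV[R]_n :=
  if pselect (chart_at p psi) then 'd (transition phi psi) (cmap phi p) xi
  else 0.

Lemma tangent_comp_law p phi (h : chart_at p phi) xi psi psi' :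
  chart_at p psi -> chart_at p psi' ->
  tangent_comp p phi xi psi' =
  'd (transition psi psi') (cmap psi p) (tangent_comp p phi xi psi).
Proof.
rewrite /tangent_comp => h1 h2; case: pselect => // a; case: pselect => // b.
exact: transition_diff_comp.
Qed.

Lemma tangent_comp_out p phi xi psi :
  ~ chart_at p psi -> tangent_comp p phi xi psi = 0.
Proof. by rewrite /tangent_comp; case: pselect. Qed.

(* The tangent vector at p with components xi in the chart phi. *)
Definition tangent_of p phi (h : chart_at p phi) (xi : 'rV[R]_n) : tangent :=
  Tangent (tangent_comp_law h xi) (@tangent_comp_out p phi xi).

Lemma tangent_ofE p phi (h : chart_at p phi) xi :
  tcomp (tangent_of h xi) phi = xi.
Proof.
by rewrite /= /tangent_comp; case: pselect => // a; exact: transition_diff_id.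
Qed.

Lemma tangent_of_tcomp v phi (h : chart_at (tbase v) phi) :
  tangent_of h (tcomp v phi) = v.
Proof.
apply: tangent_eq => //; apply/funext => psi /=.
rewrite /tangent_comp; case: pselect => hpsi; last exact/esym/tcomp_out.
by rewrite (tcomp_law h hpsi).
Qed.

(* The induced coordinates (x, xi) on the tangent bundle. *)
Definition tcoords phi (v : tangent) : 'rV[R]_n * 'rV[R]_n :=
  (cmap phi (tbase v), tcomp v phi).

Definition nonzero (v : tangent) : Prop :=
  forall phi, chart_at (tbase v) phi -> tcomp v phi != 0.

(* The range of the induced coordinates on the slit tangent bundle. *)
Definition slit phi : set ('rV[R]_n * 'rV[R]_n) :=
  [set z | cimg phi z.1 /\ z.2 != 0].

(* The expression F(x, xi) in induced coordinates of a function F on the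
   tangent bundle; it is meaningful for x in cimg phi. *)
Definition local (F : tangent -> R) phi (z : 'rV[R]_n * 'rV[R]_n) : R :=
  if pselect (chart_at (cinv phi z.1) phi) is left h then F (tangent_of h z.2)
  else 0.

Lemma localE F phi v : chart_at (tbase v) phi ->
  local F phi (tcoords phi v) = F v.
Proof.
move=> h; have e : cinv phi (cmap phi (tbase v)) = tbase v.
  by rewrite cmapK//; case: h.
rewrite /local /=; case: pselect => [h'|]; last by rewrite e.
congr F; apply: tangent_eq => //=; apply/funext => psi.
by move: h'; rewrite e => h'; rewrite -[in RHS](tangent_of_tcomp h').
Qed.

Definition dx (i : 'I_n) (f : 'rV[R]_n * 'rV[R]_n -> R) :=
  'D_((delta_mx 0 i : 'rV[R]_n), (0 : 'rV[R]_n)) f.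

Definition dxi (i : 'I_n) (f : 'rV[R]_n * 'rV[R]_n -> R) :=
  'D_((0 : 'rV[R]_n), (delta_mx 0 i : 'rV[R]_n)) f.

Definition fiber_hessian (f : 'rV[R]_n * 'rV[R]_n -> R) z : 'M[R]_n :=
  \matrix_(i, j) dxi j (dxi i f) z.

Definition positive_definite (A : 'M[R]_n) : Prop :=
  forall v : 'rV[R]_n, v != 0 -> 0 < (v *m A *m v^T) 0 0.

Definition fundamental_tensor (F : tangent -> R) phi z : 'M[R]_n :=
  2^-1 *: fiber_hessian (fun w => local F phi w ^+ 2) z.

Definition finsler_metric (F : tangent -> R) : Prop :=
  [/\ forall v, 0 <= F v,
      forall phi, atlas phi -> forall (x xi : 'rV[R]_n) (a : R),
        cimg phi x -> 0 < a ->
        local F phi (x, a *: xi) = a * local F phi (x, xi),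
      forall phi, atlas phi -> smooth_on (slit phi) (local F phi) &
      forall phi, atlas phi -> forall z, slit phi z ->
        positive_definite (fundamental_tensor F phi z)].

Definition smooth_curve (J : set R) (c : R -> M) : Prop :=
  (forall t, J t -> {for t, continuous c}) /\
  (forall phi, atlas phi ->
     smooth_on (J `&` c @^-1` cdom phi) (cmap phi \o c)).

(* The coordinates (x(t), x'(t)) of the velocity of c. *)
Definition lift_coords phi (c : R -> M) (t : R) : 'rV[R]_n * 'rV[R]_n :=
  (cmap phi (c t), (cmap phi \o c)^`() t).

Definition regular (J : set R) (c : R -> M) : Prop :=
  forall t, J t -> forall phi, chart_at (c t) phi ->
    (cmap phi \o c)^`() t != 0.

Definition energy (F : tangent -> R) phi z : R := 2^-1 * local F phi z ^+ 2.

Definition euler_lagrange (F : tangent -> R) (J : set R) (c : R -> M) : Prop :=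
  forall t, J t -> forall phi, chart_at (c t) phi -> forall i : 'I_n,
    is_derive t 1 (fun s => dxi i (energy F phi) (lift_coords phi c s))
      (dx i (energy F phi) (lift_coords phi c t)).

Definition geodesic (F : tangent -> R) (J : set R) (c : R -> M) : Prop :=
  [/\ open_interval J, smooth_curve J c, regular J c & euler_lagrange F J c].

(* c o s is the reparametrization; s is an increasing diffeomorphism J' -> J. *)
Definition projectively_equivalent (F G : tangent -> R) : Prop :=
  forall J c, geodesic F J c ->
    exists (J' : set R) (s : R -> R),
      [/\ open_interval J', smooth_on J' s, s @` J' = J,
          forall t, J' t -> 0 < s^`() t & geodesic G J' (c \o s)].

(* gam is the curve t |-> (c(t), c'(t)) on J. *)
Definition velocity_lift (J : set R) (c : R -> M) (gam : R -> tangent) : Prop :=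
  forall t, J t -> tbase (gam t) = c t /\
    forall phi, chart_at (c t) phi -> tcoords phi (gam t) = lift_coords phi c t.

Definition ttransition phi psi (z : 'rV[R]_n * 'rV[R]_n) :
    'rV[R]_n * 'rV[R]_n :=
  (transition phi psi z.1, 'd (transition phi psi) (z.1) (z.2)).

(* A smooth vector field X on the slit tangent bundle: X phi z is the pair of
   components of X along (d/dx, d/dxi) at the point with coordinates z. *)
Definition slit_vector_field
    (X : chart R n M -> 'rV[R]_n * 'rV[R]_n -> 'rV[R]_n * 'rV[R]_n) : Prop :=
  (forall phi, atlas phi -> smooth_on (slit phi) (X phi)) /\
  (forall p phi psi xi, chart_at p phi -> chart_at p psi -> xi != 0 ->
     let z := (cmap phi p, xi) in
     X psi (ttransition phi psi z) = 'd (ttransition phi psi) z (X phi z)).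

Definition integral_curve
    (X : chart R n M -> 'rV[R]_n * 'rV[R]_n -> 'rV[R]_n * 'rV[R]_n)
    (J : set R) (gam : R -> tangent) : Prop :=
  forall t, J t ->
    [/\ nonzero (gam t), {for t, continuous (fun s => tbase (gam s) : M)} &
        forall phi, chart_at (tbase (gam t)) phi ->
          is_derive t 1 (fun s => tcoords phi (gam s))
            (X phi (tcoords phi (gam t)))].

(* X is the vector field whose integral curves are the velocity curves of the
   geodesics of F; in particular X phi (x, xi) = (xi, - 2 G(x, xi)). *)
Definition geodesic_spray (F : tangent -> R)
    (X : chart R n M -> 'rV[R]_n * 'rV[R]_n -> 'rV[R]_n * 'rV[R]_n) : Prop :=
  slit_vector_field X /\
  forall J gam, open_interval J ->
    (integral_curve X J gam <->
     exists2 c, geodesic F J c & velocity_lift J c gam).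

Definition constant_along
    (X : chart R n M -> 'rV[R]_n * 'rV[R]_n -> 'rV[R]_n * 'rV[R]_n)
    (I : tangent -> R) : Prop :=
  forall J gam, open_interval J -> integral_curve X J gam ->
    forall s t, J s -> J t -> I (gam s) = I (gam t).

End TangentBundle.

Section Surface.
Variables (R : realType) (S : manifold R 2).

Definition hessian_trace (F : tangent S -> R) (phi : chart R 2 S) z : R :=
  dxi 0 (dxi 0 (local F phi)) z + dxi 1 (dxi 1 (local F phi)) z.

(* I(x, xi) in induced coordinates, for the metrics F and G. *)
Definition hessian_factor (F G : tangent S -> R) (phi : chart R 2 S) z : R :=
  hessian_trace F phi z / hessian_trace G phi z.

End Surface.

(* Main.v *)
Require Import Defs.
From HB Require Import structures.
From mathcomp Require Import all_boot all_order all_algebra.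
From mathcomp Require Import all_classical all_reals all_analysis.
From mathcomp Require Import ring lra.

Import Order.TTheory GRing.Theory Num.Theory.
Import numFieldNormedType.Exports.

(* In a chart write (p, q) for the fiber coordinates.  The fiber Hessian of a 1-homogeneous function f of (x, xi) is lam f times the
   matrix [[q^2, - p q], [- p q, p^2]], and its Euler-Lagrange expression at a
   curve with acceleration w is (q, - p) times tor f + lam f * (q w_0 - p w_1),
   where tor f is the skew part of the mixed derivatives of f.  So the
   unparametrized geodesics depend only on the quotient tor f / lam f.  Every
   nonzero vector is the velocity of a geodesic of the first metric (Picard-Lindelof),
   which is also one of the second up to reparametrization, hence the two
   metrics have the same quotient: with I the quotient of the two functions
   lam, also tor Fhat = I * tor Fcheck.  Differentiating the latter in xi with
   d_xi (tor f) = (q, - p) * (p d_x0 + q d_x1) (lam f), the derivative of I along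
   a geodesic of either metric vanishes. *)

Set Implicit Arguments.
Unset Strict Implicit.
Unset Printing Implicit Defensive.

Local Open Scope ring_scope.
Local Open Scope classical_set_scope.

(** * C^k functions between normed modules *)

(** Euler's identity is what reduces everything to scalars: the Hessian of a 1-homogeneous function
    annihilates xi, which in dimension 2 leaves the single factor [lam], and the Euler-Lagrange
    covector becomes a multiple of (q, - p). Replacing a metric by its energy adds one equation,
    constancy of the metric along the curve, which only fixes the parametrization. Positive
    definiteness enters as positivity of the metric and of [lam], so that the acceleration can be
    solved for and [lam] divided by. Projective equivalence speaks of curves; to extract a pointwise
    identity, geodesics with prescribed initial velocity must be produced, and since
    [euler_lagrange] is demanded in all charts around a point, the equation solved in one chart has
    to be carried to the others. The identity [tor F * lam G = tor G * lam F] so obtained is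
    symmetric, hence serves the geodesics of both metrics. Independence of the chart holds because a
    change of coordinates multiplies the trace of the fiber Hessian by a factor that is the same for
    all metrics. *)

Section Calculus.
Variable R : realType.

Lemma near_eq_diff (V W : normedModType R) (f g : V -> W) x :
  (\near x, f x = g x) -> differentiable f x ->
  differentiable g x /\ 'd g x = 'd f x :> (V -> W).
Proof.
move=> fg df; have [dc fo] := (diff_locallyP x f).1 df.
have fgx : f x = g x by apply: nbhs_singleton fg.
have go : g \o shift x = cst (g x) + 'd f x +o_ (0 : V) id.
  apply/eqaddoP => _ /posnumP[e].
  move: fo => /eqaddoP /(_ e%:num) /(_ [gt0 of e%:num]).
  have : \forall y \near (0 : V), f (y + x) = g (y + x).
    have h : (y + x) @[y --> (0 : V)] --> x.
      by rewrite -[X in _ --> X]add0r; apply: cvgD; [exact: cvg_id|exact: cvg_cst].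
    by move: fg => /h.
  by apply: filterS2 => y /=; rewrite fgx !fctE => ->.
have e := diff_unique dc go.
by split; [apply/diff_locallyP; rewrite e; split; [exact: dc|exact: go]|exact: e].
Qed.

Lemma scaler_is_bilinear (W : normedModType R) :
  bilinear_for
    (GRing.Scale.Law.clone _ _ *:%R _) (GRing.Scale.Law.clone _ _ *:%R _)
    (@GRing.scale R W).
Proof.
split=> [u'|u] a x y /=.
- by rewrite scalerDl scalerA.
- by rewrite scalerDr !scalerA mulrC.
Qed.

(** Chain rule through scaling, packed as a bilinear map so that [diff_bilin] gives its
    differential. *)
Lemma diff_scale (V W : normedModType R) (k : V -> R) (f : V -> W) x :
  differentiable k x -> differentiable f x ->
  differentiable (fun z => k z *: f z) x /\
  forall v, 'd (fun z => k z *: f z) x v = 'd k x v *: f x + k x *: 'd f x v.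
Proof.
move=> dk df.
pose blM := bilinear_isBilinear.Build R R W W _ _ (@GRing.scale R W)
  (@scaler_is_bilinear W).
pose b : {bilinear R -> W -> W} := HB.pack (@GRing.scale R W) blM.
have bc : continuous (fun p : R * W => b p.1 p.2) by move=> p; exact: scale_continuous.
have dp : differentiable (fun z => (k z, f z)) x by exact: differentiable_pair.
have db := differentiable_bilin (k x, f x) bc.
split; first exact: (differentiable_comp dp db).
move=> v; have /= := congr1 (fun h : V -> W => h v) (diff_comp dp db).
rewrite -[LHS]/('d (fun z => k z *: f z) x v) => ->.
by rewrite (diff_bilin _ bc) diff_pair//= addrC.
Qed.

Lemma derive_scale (V W : normedModType R) (k : V -> R) (f : V -> W) x v :
  differentiable k x -> differentiable f x ->
  'D_v (fun z => k z *: f z) x = 'D_v k x *: f x + k x *: 'D_v f x.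
Proof.
by move=> dk df; have [d e] := diff_scale dk df; rewrite !deriveE.
Qed.

Lemma derive_comp (U V W : normedModType R) (y : U -> V) (g : V -> W) t u :
  differentiable y t -> differentiable g (y t) ->
  'D_u (g \o y) t = 'D_('D_u y t) g (y t).
Proof.
move=> dy dg; rewrite !deriveE//; last exact: differentiable_comp.
by rewrite diff_comp.
Qed.

Lemma is_derive_comp (V W : normedModType R) (y : R -> V) (g : V -> W) (t : R) v :
  is_derive t 1 y v -> differentiable g (y t) ->
  is_derive t 1 (g \o y) ('D_v g (y t)).
Proof.
move=> [/derivable1_diffP dy <-] dg.
split; first exact/derivable1_diffP/differentiable_comp.
exact: derive_comp.
Qed.

Lemma deriveZdir (V W : normedModType R) (f : V -> W) x u (a : R) :
  differentiable f x -> 'D_(a *: u) f x = a *: 'D_u f x.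
Proof. by move=> df; rewrite !deriveE// linearZ. Qed.

Lemma derive_sumdir (I : finType) (V W : normedModType R) (f : V -> W) x
    (a : I -> R) (e : I -> V) :
  differentiable f x ->
  'D_(\sum_i a i *: e i) f x = \sum_i a i *: 'D_(e i) f x.
Proof.
move=> df; rewrite deriveE// linear_sum; apply: eq_bigr => i _.
by rewrite linearZ/= deriveE.
Qed.

Lemma derive_linfun (V W : normedModType R) (l : {linear V -> W}) x v :
  continuous l -> 'D_v l x = l v.
Proof. by move=> lc; rewrite deriveE ?diff_lin//; exact: linear_differentiable. Qed.

End Calculus.

Section Ck.
Variable R : realType.
Implicit Types (U V W : normedModType R).

(** On an open set, equality on [A] is equality near each point, which derivatives respect. The
    closure lemmas below compute ['D_v] on [A] by a formula and transport the class along it. *)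
Lemma Ck_ext k V W (A : set V) (f g : V -> W) : open A ->
  (forall x, A x -> f x = g x) -> Ck_on k A f -> Ck_on k A g.
Proof.
move=> oA; elim: k f g => [|k IH] f g fg /=.
  move=> fc x Ax; have n : \near x, f x = g x.
    by apply: filterS (open_nbhs_nbhs (conj oA Ax)) => y /fg.
  have h := cvg_trans (near_eq_cvg n) (fc x Ax : f @ x --> f x).
  by rewrite (fg x Ax) in h; exact: h.
move=> [df Df]; split => [x Ax|v].
  have n : \near x, f x = g x.
    by apply: filterS (open_nbhs_nbhs (conj oA Ax)) => y /fg.
  by have [] := near_eq_diff n (df _ Ax).
apply: IH (Df v) => x Ax; apply: near_eq_derive.
by apply: filterS (open_nbhs_nbhs (conj oA Ax)) => y /fg.
Qed.

Lemma Ck_sub k V W (A B : set V) (f : V -> W) : B `<=` A ->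
  Ck_on k A f -> Ck_on k B f.
Proof.
move=> BA; elim: k f => [|k IH] f /=; first by move=> h x /BA; exact: h.
by move=> [df Df]; split=> [x /BA|v]; [exact: df|exact/IH/Df].
Qed.

Lemma Ck_pred k V W (A : set V) (f : V -> W) : Ck_on k.+1 A f -> Ck_on k A f.
Proof.
elim: k f => [|k IH] f /=.
  by move=> [df _] x /df; exact: differentiable_continuous.
by move=> [df Df]; split=> // v; apply: IH; exact: Df.
Qed.

Lemma Ck_cst k V W (A : set V) (a : W) : Ck_on k A (fun=> a).
Proof.
elim: k a => [|k IH] a /=; first by move=> x _; exact: cvg_cst.
split=> [x _|v]; first exact: differentiable_cst.
rewrite (_ : 'D_v _ = fun=> 0); first exact: IH.
by apply/funext => x; exact: derive_cst.
Qed.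

Lemma Ck_lin k V W (A : set V) (l : {linear V -> W}) : continuous l ->
  Ck_on k A l.
Proof.
move=> lc; case: k => [|k] /=; first by move=> x _; exact: lc.
split=> [x _|v]; first exact: linear_differentiable.
rewrite (_ : 'D_v _ = fun=> l v); first exact: Ck_cst.
by apply/funext => x; exact: derive_linfun.
Qed.

Lemma CkD k V W (A : set V) (f g : V -> W) : open A ->
  Ck_on k A f -> Ck_on k A g -> Ck_on k A (fun x => f x + g x).
Proof.
move=> oA; elim: k f g => [|k IH] f g /=.
  by move=> fc gc x Ax; apply: cvgD; [exact: fc|exact: gc].
move=> [df Df] [dg Dg]; split=> [x Ax|v].
  by apply: differentiableD; [exact: df|exact: dg].
apply: (@Ck_ext _ _ _ _ (fun x => 'D_v f x + 'D_v g x)) => //.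
  move=> x Ax; rewrite -deriveD//; apply: diff_derivable; [exact: df|exact: dg].
exact: IH.
Qed.

Lemma CkZ k V W (A : set V) (a : V -> R) (f : V -> W) : open A ->
  Ck_on k A a -> Ck_on k A f -> Ck_on k A (fun x => a x *: f x).
Proof.
move=> oA; elim: k a f => [|k IH] a f.
  by move=> /= fc gc x Ax; apply: cvgZ; [exact: fc|exact: gc].
move=> ca cf; have [da Da] := ca; have [df Df] := cf; split=> [x Ax|v].
  by have [] := diff_scale (da _ Ax) (df _ Ax).
apply: (@Ck_ext _ _ _ _ (fun x => 'D_v a x *: f x + a x *: 'D_v f x)) => //.
  move=> x Ax; rewrite derive_scale//; [exact: da|exact: df].
by apply: (CkD oA); apply: IH; [exact: Da|exact: Ck_pred|exact: Ck_pred|exact: Df].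
Qed.

Lemma CkM k V (A : set V) (f g : V -> R) : open A ->
  Ck_on k A f -> Ck_on k A g -> Ck_on k A (fun x => f x * g x).
Proof. exact: CkZ. Qed.

Lemma CkN k V W (A : set V) (f : V -> W) : open A ->
  Ck_on k A f -> Ck_on k A (fun x => - f x).
Proof.
move=> oA cf; apply: (@Ck_ext _ _ _ _ (fun x => (-1 : R) *: f x)) => //.
  by move=> x _; rewrite scaleN1r.
by apply: CkZ => //; exact: Ck_cst.
Qed.

Lemma Ck_sum k V W (A : set V) (I : finType) (f : I -> V -> W) : open A ->
  (forall i, Ck_on k A (f i)) -> Ck_on k A (fun x => \sum_i f i x).
Proof.
move=> oA cf; rewrite /index_enum; elim: (Finite.enum _) => [|i s IH].
  by apply: (@Ck_ext _ _ _ _ (fun=> 0)) => // [x _|]; [rewrite big_nil|exact: Ck_cst].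
apply: (@Ck_ext _ _ _ _ (fun x => f i x + \sum_(j <- s) f j x)) => //.
  by move=> x _; rewrite big_cons.
exact: CkD.
Qed.

Lemma CkV k V (A : set V) (f : V -> R) : open A ->
  (forall x, A x -> f x != 0) -> Ck_on k A f -> Ck_on k A (fun x => (f x)^-1).
Proof.
move=> oA f0; elim: k => [|k IH].
  by move=> /= fc x Ax; apply: cvgV; [exact: f0|exact: fc].
move=> cf; have [df Df] := cf; have ci := IH (Ck_pred cf); split=> [x Ax|v].
  by apply: differentiableV; [exact: df|exact: f0].
apply: (@Ck_ext _ _ _ _ (fun x => - ((f x)^-1 * (f x)^-1 * 'D_v f x))) => //.
  move=> x Ax; rewrite deriveV ?f0//; last exact/diff_derivable/df.
  by rewrite -expr2 -exprVn scaleNr.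
by apply: (CkN oA); apply: (CkM oA (CkM oA ci ci)); exact: Df.
Qed.

(** A finite spanning family with continuous coordinate functionals: the form in which finite
    dimension is used, common to row vectors and to pairs of them. Independence is not asked. *)
Definition frame (I : finType) V (e : I -> V) (l : I -> {linear V -> R}) : Prop :=
  (forall i, continuous (l i)) /\ forall v, v = \sum_i l i v *: e i.

Lemma Ck_linl k V W W' (A : set V) (l : {linear W -> W'}) (f : V -> W) : open A ->
  continuous l -> Ck_on k A f -> Ck_on k A (fun x => l (f x)).
Proof.
move=> oA lc; elim: k f => [|k IH] f.
  by move=> /= fc x Ax; apply: continuous_comp; [exact: fc|exact: lc].
have dl w : differentiable l w by exact: linear_differentiable.
move=> [df Df]; split=> [x Ax|v].
  exact: (differentiable_comp (df _ Ax) (dl (f x))).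
apply: (@Ck_ext _ _ _ _ (fun x => l ('D_v f x)) _ oA); last exact/IH/Df.
move=> x Ax; rewrite -[RHS]/('D_v (l \o f) x) [RHS]derive_comp//; last exact: df.
by rewrite [RHS]derive_linfun.
Qed.

(** The chain rule gives ['D_v (g \o y)] as a derivative of [g] in the direction ['D_v y x], which
    varies with [x], while [Ck_on] only speaks of fixed directions. The frame expands it over the
    fixed directions [e i], and the induction goes through. *)
Lemma Ck_comp k (U V W : normedModType R) (A : set U) (B : set V)
    (I : finType) (e : I -> V) (l : I -> {linear V -> R})
    (y : U -> V) (g : V -> W) :
  frame e l -> open A -> (forall x, A x -> B (y x)) ->
  Ck_on k A y -> Ck_on k B g -> Ck_on k A (fun x => g (y x)).
Proof.
move=> [lc le] oA yAB; elim: k g => [|k IH] g.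
  by move=> /= cy cg x Ax; apply: continuous_comp; [exact: cy|exact/cg/yAB].
move=> cy; have [dy Dy] := cy => -[dg Dg]; split=> [x Ax|v].
  exact: (differentiable_comp (dy _ Ax) (dg _ (yAB _ Ax))).
apply: (@Ck_ext _ _ _ _
  (fun x => \sum_i l i ('D_v y x) *: 'D_(e i) g (y x))) => //.
  move=> x Ax; have dx := dg _ (yAB _ Ax).
  rewrite -[RHS]/('D_v (g \o y) x) [RHS]derive_comp//; last exact: dy.
  by rewrite [in RHS](le ('D_v y x)) derive_sumdir.
apply: (Ck_sum oA) => i; apply: (CkZ oA); first exact/(Ck_linl oA (lc i))/Dy.
by apply: (IH ('D_(e i) g)); [exact: Ck_pred|exact: Dg].
Qed.

End Ck.

(** * Symmetry of second derivatives *)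

Section Schwarz.
Variable R : realType.

Lemma is_derive_line (V : normedModType R) (w u : V) (s : R) :
  is_derive s 1 (fun s : R => w + s *: u) u.
Proof.
have d : differentiable (fun s : R => s *: u) s.
  by apply: (@diff_scale _ _ _ id (cst u) s _ _).1.
have dl : is_derive s 1 (fun s : R => s *: u) u.
  apply: DeriveDef; first exact: diff_derivable d.
  rewrite (@derive_scale _ _ _ id (cst u))// derive_id derive_cst.
  by rewrite scale1r scaler0 addr0.
have := @is_deriveD _ _ _ (cst w) (fun s : R => s *: u) s 1 0 u (is_derive_cst _ _ _) dl.
by rewrite add0r.
Qed.

Lemma diff_approx (V : normedModType R) (g : V -> R) z (e : R) :
  differentiable g z -> 0 < e ->
  exists2 d : R, 0 < d &
    forall k, `|k| < d -> `|g (z + k) - g z - 'd g z k| <= e * `|k|.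
Proof.
move=> dg e0; have [_ ] := (diff_locallyP z g).1 dg.
move=> /eqaddoP /(_ e e0) /nbhs_ballP[d /= d0 hd].
exists d => // k kd; have := hd k.
rewrite -ball_normE /ball_/= sub0r normrN => /(_ kd).
by rewrite !fctE /= opprD addrA [k + z]addrC.
Qed.

(** The mean value theorem for s |-> f (z + h v + s u) - f (z + s u) on [0, h] turns the second
    difference into h times a difference of two values of ['D_u f]; both are expanded at [z], where
    alone ['D_u f] is differentiable. *)
Lemma second_difference (V : normedModType R) (f : V -> R) z u v (e : R) :
  (\forall x \near z, differentiable f x) -> differentiable ('D_u f) z ->
  0 < e ->
  exists2 d : R, 0 < d & forall h : R, 0 < h < d ->
    `|(f (z + h *: u + h *: v) - f (z + h *: u) - f (z + h *: v) + f z)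
      - h ^+ 2 * 'D_v ('D_u f) z| <= e * h ^+ 2.
Proof.
move=> nf; set g : V -> R := 'D_u f => dg e0.
(* The two displacements s u + h v and s u have total norm at most h (|u| + |v| + |u|); the 1 keeps
   the divisor positive. *)
have N0 : 0 < `|u| + `|v| + `|u| + 1.
  by rewrite ltr_wpDl// !addr_ge0.
have [d1 d10 hd1] := diff_approx dg (divr_gt0 e0 N0).
move: nf => /nbhs_ballP[d2 /= d20 hd2].
have df k : `|k| < d2 -> differentiable f (z + k).
  move=> kd; apply: hd2; rewrite -ball_normE /ball_/=.
  by rewrite opprD addrA subrr sub0r normrN.
exists (Num.min d1 d2 / (`|u| + `|v| + `|u| + 1)).
  by rewrite divr_gt0// lt_min d10.
move=> h /andP[h0]; rewrite ltr_pdivlMr// lt_min => /andP[hd1' hd2'].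
have small s : 0 <= s <= h -> `|s *: u + h *: v| <= h * (`|u| + `|v|).
  move=> /andP[s0 sh]; apply: le_trans (ler_normD _ _) _.
  rewrite !normrZ mulrDr (ger0_norm s0) (gtr0_norm h0) lerD2r.
  exact: ler_wpM2r.
have small' s : 0 <= s <= h -> `|s *: u| <= h * `|u|.
  by move=> /andP[s0 sh]; rewrite !normrZ (ger0_norm s0); exact: ler_wpM2r.
have b1 : h * (`|u| + `|v|) <= h * (`|u| + `|v| + `|u| + 1).
  by rewrite ler_pM2l// -addrA lerDl addr_ge0.
have b2 : h * `|u| <= h * (`|u| + `|v| + `|u| + 1).
  by rewrite ler_pM2l// -!addrA lerDl !addr_ge0.
pose phi s := f (z + h *: v + s *: u) - f (z + s *: u).
have dphi s : 0 <= s <= h -> is_derive s 1 phi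
    (g (z + h *: v + s *: u) - g (z + s *: u)).
  move=> sh; apply: is_deriveB.
    apply: (@is_derive_comp _ _ _ (fun s : R => z + h *: v + s *: u)).
      exact: is_derive_line.
    rewrite -addrA [h *: v + _]addrC; apply: df.
    exact: le_lt_trans (small _ sh) (le_lt_trans b1 _).
  apply: (@is_derive_comp _ _ _ (fun s : R => z + s *: u)).
    exact: is_derive_line.
  apply: df; exact: le_lt_trans (small' _ sh) (le_lt_trans b2 _).
have [||s sI] := @MVT R phi (fun s => g (z + h *: v + s *: u) - g (z + s *: u)) 0 h h0.
- by move=> s /[!in_itv]/= /andP[/ltW s0 /ltW sh]; apply: dphi; rewrite s0.
- apply: derivable_within_continuous => s /[!in_itv]/= sh.
  by have [] := dphi _ sh.
rewrite /phi scale0r !addr0 subr0.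
have sh : 0 <= s <= h by move: sI => /[!in_itv]/= /andP[/ltW -> /ltW ->].
have r1 := hd1 _ (le_lt_trans (small _ sh) (le_lt_trans b1 hd1')).
have r2 := hd1 _ (le_lt_trans (small' _ sh) (le_lt_trans b2 hd1')).
move=> E; have {}E : f (z + h *: u + h *: v) - f (z + h *: u) - f (z + h *: v) + f z
   = (g (z + (s *: u + h *: v)) - g (z + s *: u)) * h.
  rewrite [s *: u + h *: v]addrC addrA -E [z + h *: v + h *: u]addrAC; ring.
rewrite E deriveE//.
set A := g (z + (_ + _)) in r1 *; set B := g (z + _) in r2 *; set C := g z in r1 r2.
set D : R := 'd g z v; set D' : R := 'd g z u.
set e' := e / _ in r1 r2 *.
have {}r1 : `|A - C - (s * D' + h * D)| <= e' * `|s *: u + h *: v|.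
  by move: r1; rewrite linearD !linearZ.
have {}r2 : `|B - C - s * D'| <= e' * `|s *: u| by move: r2; rewrite linearZ.
have -> : (A - B) * h - h ^+ 2 * D = h * ((A - C - (s * D' + h * D)) - (B - C - s * D')).
  by ring.
rewrite normrM (gtr0_norm h0) expr2 mulrCA ler_pM2l//.
apply: le_trans (ler_normB _ _) _; apply: (le_trans (lerD r1 r2)).
have e'0 : 0 <= e' by rewrite divr_ge0// ltW.
rewrite -mulrDr; apply: (@le_trans _ _ (e' * (h * (`|u| + `|v| + `|u| + 1)))).
  rewrite ler_wpM2l//; apply: le_trans (lerD (small _ sh) (small' _ sh)) _.
  by rewrite -mulrDr ler_pM2l// lerDl.
by rewrite mulrCA /e' divfK ?gt_eqF// mulrC.
Qed.

(** The second difference is symmetric in [u] and [v], and approximates h^2 times either mixed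
    derivative up to (e / 2) h^2. *)
Lemma derive_schwarz (V : normedModType R) (f : V -> R) z u v :
  (\forall x \near z, differentiable f x) ->
  differentiable ('D_u f) z -> differentiable ('D_v f) z ->
  'D_v ('D_u f) z = 'D_u ('D_v f) z.
Proof.
move=> nf du dv; apply/eqP; rewrite -subr_eq0 -normr_le0; apply/ler_addgt0Pl => e e0.
rewrite addr0; have e20 : 0 < e / 2 by rewrite divr_gt0.
have [d1 d10 h1] := second_difference v nf du e20.
have [d2 d20 h2] := second_difference u nf dv e20.
pose h := Num.min d1 d2 / 2.
have m0 : 0 < Num.min d1 d2 by rewrite lt_min d10.
have h0 : 0 < h by rewrite divr_gt0.
have hm : h < Num.min d1 d2 by rewrite ltr_pdivrMr// mulr_natr mulr2n ltrDl.
have {}h1 := h1 h; have {}h2 := h2 h; move: hm; rewrite lt_min => /andP[hm1 hm2].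
move: h1 h2; rewrite h0 hm1 hm2 => /(_ isT) h1 /(_ isT) h2.
have hh : 0 < h ^+ 2 by rewrite exprn_gt0.
rewrite -(ler_pM2r hh) -[X in `|_| * X]gtr0_norm// -normrM.
move: h1 h2; rewrite [z + h *: v + h *: u]addrAC.
move: (f _) (f _) (f _) (f _) ('D_v _ _) ('D_u _ _) => a b c d X Y h1 h2.
have -> : (X - Y) * h ^+ 2 = (d - b - c + a - h ^+ 2 * Y) - (d - c - b + a - h ^+ 2 * X) by ring.
apply: le_trans (ler_normB _ _) _; apply: (le_trans (lerD h2 h1)).
by rewrite -mulrDl -splitr.
Qed.

Lemma smooth_schwarz (V : normedModType R) (A : set V) (f : V -> R) z u v :
  open A -> smooth_on A f -> A z -> 'D_v ('D_u f) z = 'D_u ('D_v f) z.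
Proof.
move=> oA sf Az; have [df Df] := sf 2; apply: derive_schwarz.
- by apply: filterS (open_nbhs_nbhs (conj oA Az)) => x; exact: df.
- exact: (Df u).1.
- exact: (Df v).1.
Qed.

End Schwarz.

(** * Existence of solutions of ordinary differential equations *)

Section Primitive.
Variable R : realType.

(** The integral from 0 to [x] for either sign of [x], as long as [x] lies above -1; all times used
    later have absolute value less than 1. *)
Definition primitive (f : R -> R) (x : R) : R :=
  (\int[lebesgue_measure]_(t in `[(- 1), x]) f t) -
  (\int[lebesgue_measure]_(t in `[(- 1), 0]) f t).

Lemma primitive0 f : primitive f 0 = 0.
Proof. exact: subrr. Qed.

Lemma is_derive_primitive (f : R -> R) (t : R) : continuous f -> `|t| < 1 ->
  is_derive t 1 (primitive f) (f t).
Proof.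
move=> cf; rewrite ltr_norml => /andP[t0 t1].
have fi : lebesgue_measure.-integrable `[(- 1)%R, 1%R] (EFin \o f).
  apply: continuous_compact_integrable; first exact: segment_compact.
  exact: continuous_subspaceT.
have [d e] := @continuous_FTC1_closed R f (- 1) t 1 t1 fi t0 (cf t).
have h : is_derive t 1 (fun x => \int[lebesgue_measure]_(t in `[(- 1), x]) f t)%R (f t).
  by split; [exact: d|rewrite -derive1E; exact: e].
have := is_deriveB h (is_derive_cst
  (\int[lebesgue_measure]_(t in `[(- 1), 0]) f t)%R t 1).
by rewrite subr0.
Qed.

(** 2 M / 2^n is the tail of the geometric series, so the intervals of that radius around [u n] are
    nested; the limit is the supremum of their lower ends. *)
Lemma geometric_cauchy (u : nat -> R) (M : R) : 0 <= M ->
  (forall n, `|u n.+1 - u n| <= M / 2 ^+ n) ->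
  exists L, forall n, `|u n - L| <= 2 * M / 2 ^+ n.
Proof.
move=> M0 hu; pose a n := u n - 2 * M / 2 ^+ n; pose b n := u n + 2 * M / 2 ^+ n.
have half n : 2 * M / 2 ^+ n = 2 * M / 2 ^+ n.+1 + M / 2 ^+ n.
  by rewrite exprS invfM; field; rewrite expf_neq0.
have aS n : a n <= a n.+1.
  by have := hu n; rewrite ler_norml /a (half n) => /andP[]; lra.
have bS n : b n.+1 <= b n.
  by have := hu n; rewrite ler_norml /b (half n) => /andP[]; lra.
have am n k : a n <= a (k + n)%N.
  by elim: k => [|k IH] //; apply: le_trans IH _; exact: aS.
have bm n k : b (k + n)%N <= b n.
  by elim: k => [|k IH] //; apply: le_trans IH; exact: bS.
have ab n m : a n <= b m.
  apply: le_trans (am n m) _; apply: le_trans (bm m n); rewrite addnC.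
  by rewrite /a /b lerD2l ge0_cp// divr_ge0 ?mulr_ge0// exprn_ge0.
exists (sup (range a)) => n; rewrite ler_norml.
have h1 : a n <= sup (range a).
  apply: ub_le_sup; last by exists n.
  by exists (b 0) => _ [m _ <-].
have h2 : sup (range a) <= b n.
  by apply: ge_sup; [exists (a 0), 0%N|move=> _ [m _ <-]].
by rewrite /a /b in h1 h2; apply/andP; split; lra.
Qed.

End Primitive.

Section Frame.
Variables (R : realType) (V : normedModType R) (I : finType).
Variables (e : I -> V) (l : I -> {linear V -> R}).
Hypothesis fr : frame e l.

Lemma frame_coord_bound : exists2 c : R, 0 < c & forall i v, `|l i v| <= c * `|v|.
Proof.
have /choice[k hk] i : exists k : R, 0 < k /\ forall x, `|l i x| <= k * `|x|.
  by have [k k0 h] := linear_lipschitz (fr.1 i); exists k.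
exists (1 + \sum_i k i).
  by rewrite ltr_wpDr// sumr_ge0// => i _; apply/ltW/(hk i).1.
move=> i v; apply: le_trans ((hk i).2 v) _; apply: ler_wpM2r => //.
rewrite (bigD1 i)//= addrCA lerDl addr_ge0// sumr_ge0// => j _.
by apply/ltW/(hk j).1.
Qed.

Definition frame_size : R := 1 + \sum_i `|e i|.

Lemma frame_size_gt0 : 0 < frame_size.
Proof. by rewrite ltr_wpDr// sumr_ge0. Qed.

Lemma frame_sum_bound (a : I -> R) (M : R) : 0 <= M -> (forall i, `|a i| <= M) ->
  `|\sum_i a i *: e i| <= M * frame_size.
Proof.
move=> M0 ha; apply: le_trans (ler_norm_sum _ _ _) _.
rewrite /frame_size mulrDr mulr1 mulr_sumr.
apply: (@le_trans _ _ (\sum_i M * `|e i|)); last by rewrite lerDr.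
by apply: ler_sum => i _; rewrite normrZ ler_wpM2r.
Qed.

(** The mean value theorem holds for real functions, hence coordinate by coordinate; [C] pays for
    reassembling the vector and depends on the frame only, not on the curve. *)
Lemma frame_mvt : exists2 C : R, 0 < C &
  forall (y dy : R -> V) (M : R),
    (forall s : R, 0 <= s <= 1 -> is_derive s 1 y (dy s) /\ `|dy s| <= M) ->
    `|y 1 - y 0| <= C * M.
Proof.
have [c c0 hc] := frame_coord_bound.
exists (c * frame_size); first by rewrite mulr_gt0// frame_size_gt0.
move=> y dy M hy.
have M0 : 0 <= M by apply: le_trans (hy 0 _).2; rewrite ?lexx ?ler01.
rewrite (fr.2 (y 1 - y 0)) mulrAC; apply: frame_sum_bound.
  by rewrite mulr_ge0// ltW.
move=> i.
have dl (s : R) : 0 <= s <= 1 -> is_derive s 1 (l i \o y) (l i (dy s)).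
  move=> s01; have [d _] := hy s s01.
  have := is_derive_comp d (linear_differentiable (y s) (fr.1 i)).
  by rewrite (derive_linfun _ _ (fr.1 i)).
have [||s sI] := @MVT R (l i \o y) (fun s => l i (dy s)) 0 1 ltr01.
- by move=> s /[!in_itv]/= /andP[/ltW s0 /ltW sh]; apply: dl; rewrite s0.
- apply: derivable_within_continuous => s /[!in_itv]/= sh.
  by have [] := dl _ sh.
rewrite subr0 mulr1 /= -linearB => ->.
apply: le_trans (hc _ _) _; apply: ler_wpM2l; first exact: ltW.
by apply: (hy s _).2; move: sI => /[!in_itv]/= /andP[/ltW -> /ltW ->].
Qed.

(** The completeness of [V] needed for Picard iteration, obtained from that of the reals in each
    coordinate. *)
Lemma frame_geometric_cauchy (M : R) : 0 <= M -> exists2 C, 0 <= C &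
  forall u : nat -> V, (forall n, `|u n.+1 - u n| <= M / 2 ^+ n) ->
    exists y, forall n, `|u n - y| <= C / 2 ^+ n.
Proof.
move=> M0; have [c c0 hc] := frame_coord_bound.
have cM : 0 <= c * M by rewrite mulr_ge0// ltW.
exists (2 * (c * M) * frame_size).
  by rewrite mulr_ge0 ?mulr_ge0// ltW// frame_size_gt0.
move=> u hu.
have /choice[L hL] i : exists L, forall n, `|l i (u n) - L| <= 2 * (c * M) / 2 ^+ n.
  apply: geometric_cauchy => // n; rewrite -linearB.
  by apply: le_trans (hc _ _) _; rewrite -mulrA ler_pM2l.
exists (\sum_i L i *: e i) => n; rewrite (fr.2 (u n)) -sumrB mulrAC.
under eq_bigr do rewrite -scalerBl.
apply: frame_sum_bound; last by move=> i; exact: hL.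
by rewrite divr_ge0 ?exprn_ge0// mulr_ge0.
Qed.

End Frame.

(** * Picard-Lindelof theorem and smoothness of solutions *)

Section ODE.
Variables (R : realType) (V : normedModType R) (I : finType).
Variables (e : I -> V) (l : I -> {linear V -> R}).
Hypothesis fr : frame e l.

Definition clamp (d x : R) : R := if x < - d then - d else if d < x then d else x.

Lemma clamp_le d x : 0 <= d -> `|clamp d x| <= d.
Proof.
move=> d0; rewrite ler_norml /clamp; apply/andP.
by case: (ltP x (- d)) => h1; [|case: (ltP d x) => h2]; split; lra.
Qed.

Lemma clamp_id d x : `|x| <= d -> clamp d x = x.
Proof. by rewrite ler_norml /clamp => /andP[h1 h2]; rewrite !ltNge h1 h2. Qed.

Lemma clamp_lipschitz d x y : 0 <= d -> `|clamp d x - clamp d y| <= `|x - y|.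
Proof.
move=> d0; have := ler_norm (x - y); have := ler_norm (y - x); rewrite [`|y - x|]distrC.
set N := `|x - y| => n1 n2; rewrite ler_norml /clamp; apply/andP.
by case: (ltP x (- d)) => h1; case: (ltP y (- d)) => h2;
  try (case: (ltP d x) => h3); try (case: (ltP d y) => h4); split; lra.
Qed.

Lemma clamp_continuous d : 0 <= d -> continuous (clamp d).
Proof.
move=> d0 x; apply/cvgrPdist_lt => r r0; near=> y.
apply: le_lt_trans (clamp_lipschitz _ _ d0) _.
by near: y; apply: cvgr_dist_lt.
Unshelve. all: by end_near. Qed.

Lemma lipschitz_continuous (W W' : normedModType R) (f : W -> W') (K : R) :
  0 <= K -> (forall x y, `|f x - f y| <= K * `|x - y|) -> continuous f.
Proof.
move=> K0 fK x; apply/cvgrPdist_lt => r r0; near=> y.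
apply: (@le_lt_trans _ _ ((K + 1) * `|x - y|)).
  by apply: le_trans (fK _ _) _; rewrite ler_wpM2r// lerDl.
rewrite mulrC -ltr_pdivlMr ?ltr_wpDl//; near: y.
apply: cvgr_dist_lt; first exact: cvg_id.
by rewrite divr_gt0// ltr_wpDl.
Unshelve. all: by end_near. Qed.

Definition vprimitive (g : R -> V) (t : R) : V :=
  \sum_i primitive (fun s => l i (g s)) t *: e i.

Lemma vprimitive0 g : vprimitive g 0 = 0.
Proof. by apply: big1 => i _; rewrite primitive0 scale0r. Qed.

Lemma is_derive_fsum (J : finType) (W W' : normedModType R) (h : J -> W -> W')
    (x v : W) (dh : J -> W') :
  (forall j, is_derive x v (h j) (dh j)) ->
  is_derive x v (fun y => \sum_j h j y) (\sum_j dh j).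
Proof.
move=> dhj; rewrite /index_enum; elim: (Finite.enum _) => [|j s IH].
  rewrite big_nil; apply: near_eq_is_derive (is_derive_cst 0 x v).
  by near=> y; rewrite big_nil.
rewrite big_cons; apply: near_eq_is_derive (is_deriveD (dhj j) IH).
by near=> y; rewrite big_cons.
Unshelve. all: by end_near. Qed.

Lemma is_derive_vprimitive (g : R -> V) (t : R) : continuous g -> `|t| < 1 ->
  is_derive t 1 (vprimitive g) (g t).
Proof.
move=> gc t1; rewrite [X in is_derive _ _ _ X](fr.2 (g t)).
apply: is_derive_fsum => i.
have lgc : continuous (fun s => l i (g s)).
  by move=> s; apply: continuous_comp; [exact: gc|exact: fr.1].
have [/derivable1_diffP d dE] := is_derive_primitive lgc t1.
have dc : differentiable (cst (e i) : R -> V) t by exact: differentiable_cst.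
have [h _] := diff_scale d dc.
split; first exact: diff_derivable h.
by rewrite (derive_scale _ d dc) dE derive_cst scaler0 addr0.
Qed.

(** [frame_mvt] along s |-> s t, whose speed contributes the factor |t|, for either sign of [t]. *)
Lemma vprimitive_bound : exists2 C : R, 0 < C & forall (g h : R -> V) (M : R),
  continuous g -> continuous h -> (forall t, `|g t - h t| <= M) ->
  forall t, `|t| < 1 -> `|vprimitive g t - vprimitive h t| <= C * M * `|t|.
Proof.
have [C C0 hC] := frame_mvt fr; exists C => // g h M gc hc M1 t t1.
pose y (s : R) := vprimitive g (s * t) - vprimitive h (s * t).
have -> : vprimitive g t - vprimitive h t = y 1 - y 0.
  by rewrite /y mul1r mul0r !vprimitive0 !subr0.
rewrite -mulrA.
apply: (hC y (fun s => t *: (g (s * t) - h (s * t)))) => s /andP[s0 s1].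
split; last by rewrite normrZ mulrC ler_wpM2r.
have st : `|s * t| < 1.
  by rewrite normrM (ger0_norm s0); apply: le_lt_trans t1; rewrite ler_piMl.
have ld : is_derive s 1 (fun s : R => s * t) t.
  have := is_derive_line 0 t s; apply: near_eq_is_derive.
  by near=> x; rewrite add0r.
have key k : continuous k ->
    is_derive s 1 (fun s : R => vprimitive k (s * t)) (t *: k (s * t)).
  move=> kc; have dk := is_derive_vprimitive kc st.
  have dfk : differentiable (vprimitive k) (s * t) by apply/derivable1_diffP; case: dk.
  have := is_derive_comp ld dfk.
  have -> : 'D_t (vprimitive k) (s * t) = t *: k (s * t) => //.
  rewrite -[X in derive _ _ X]mulr1 -[t * 1]/(t *: (1 : R)) deriveZdir//.
  by case: dk => _ ->.
rewrite scalerBr; apply: is_deriveB; exact: key.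
Unshelve. all: by end_near. Qed.

(* Picard iteration; time is clamped to [- d, d] so that all iterates are
   continuous and comparable on the whole line. *)
Lemma ode_lipschitz (f : V -> V) (K : R) (y0 : V) : 0 <= K ->
  (forall x y, `|f x - f y| <= K * `|x - y|) ->
  exists2 d : R, 0 < d & exists2 y : R -> V, y 0 = y0 &
    forall t : R, `|t| < d -> is_derive t 1 y (f (y t)).
Proof.
move=> K0 fK; have fc := lipschitz_continuous K0 fK.
have [C C0 hC] := vprimitive_bound.
(* Chosen so that C K d <= 1/2, which makes the Picard operator halve distances, and d < 1, the
   range where [primitive] is differentiated. *)
pose d : R := (2 * (C * K + 1))^-1.
have CK0 : 0 <= C * K by rewrite mulr_ge0// ltW.
have d0 : 0 < d by rewrite invr_gt0 mulr_gt0// ltr_wpDl.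
have d1 : d < 1.
  by rewrite invf_lt1 ?mulr_gt0 ?ltr_wpDl//; lra.
have CKd : C * K * d <= 2^-1.
  rewrite /d invfM mulrCA ler_piMr// ler_pdivrMr ?ltr_wpDl//; lra.
pose T (y : R -> V) (t : R) := y0 + vprimitive (f \o y) (clamp d t).
have cd t : `|clamp d t| <= d by apply: clamp_le; exact: ltW.
have cd1 t : `|clamp d t| < 1 by apply: le_lt_trans (cd t) d1.
have fyc (y : R -> V) : continuous y -> continuous (f \o y).
  by move=> yc s; apply: continuous_comp; [exact: yc|exact: fc].
have Tc (y : R -> V) : continuous y -> continuous (T y).
  move=> yc s; apply: cvgD; first exact: cvg_cst.
  apply: continuous_comp; first exact/clamp_continuous/ltW.
  have [h _] := is_derive_vprimitive (fyc _ yc) (cd1 s).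
  exact/differentiable_continuous/derivable1_diffP.
have Tctr y z M : continuous y -> continuous z -> (forall t, `|y t - z t| <= M) ->
    forall t, `|T y t - T z t| <= M / 2.
  move=> yc zc yz t; rewrite /T opprD addrACA subrr add0r.
  have M0 : 0 <= M by apply: le_trans (yz 0).
  have h s : `|f (y s) - f (z s)| <= K * M.
    by apply: le_trans (fK _ _) _; apply: ler_wpM2l.
  apply: le_trans (hC _ _ _ (fyc _ yc) (fyc _ zc) h _ (cd1 t)) _.
  rewrite mulrA [_ * M]mulrC -mulrA ler_wpM2l//.
  by apply: le_trans CKd; rewrite ler_wpM2l.
pose Y n : R -> V := iter n T (cst y0).
have Yc n : continuous (Y n).
  by elim: n => [|n IH] /=; [move=> x; exact: cvg_cst|exact: Tc].
pose M := C * `|f y0|.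
have M0 : 0 <= M by rewrite mulr_ge0// ltW.
have Y01 t : `|Y 1 t - Y 0 t| <= M.
  rewrite /Y /= /T /cst addrC addKr.
  have h s : `|(f \o cst y0) s - (cst 0 : R -> V) s| <= `|f y0| by rewrite subr0.
  have c0 : continuous (cst 0 : R -> V) by move=> s; exact: cvg_cst.
  have := hC _ (cst 0) _ (fyc _ (Yc 0)) c0 h _ (cd1 t).
  have -> : vprimitive (cst 0) (clamp d t) = 0.
    apply: big1 => i _; rewrite (_ : (fun s => _) = cst 0); last first.
      by apply/funext => s; rewrite /cst linear0.
    by rewrite /primitive /Rintegral /= !integral0 subrr scale0r.
  rewrite subr0 => h'.
  apply: le_trans h' _.
  by rewrite ler_piMr// ltW.
have YS n t : `|Y n.+1 t - Y n t| <= M / 2 ^+ n.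
  elim: n t => [|n IH] t; first by rewrite expr0 divr1; exact: Y01.
  by rewrite exprSr invfM mulrA; exact: (Tctr _ _ _ (Yc n.+1) (Yc n) IH t).
have [D D0 hD] := frame_geometric_cauchy fr M0.
have /choice[y hy] t : exists L, forall n, `|Y n t - L| <= D / 2 ^+ n.
  by apply: hD => n; exact: YS.
have small r : 0 < r -> exists n, D / 2 ^+ n < r.
  move=> r0; have [n hn] : exists n : nat, D / r < n%:R.
    by exists (Num.bound (D / r)); apply: archi_boundP; rewrite divr_ge0// ltW.
  exists n; rewrite ltr_pdivrMr ?exprn_gt0// mulrC -ltr_pdivrMr//.
  apply: lt_trans hn _; rewrite -natrX ltr_nat; exact: ltn_expl.
have yc : continuous y.
  move=> s; apply/cvgrPdist_lt => r r0.
  have [n hn] := small (r / 3) (divr_gt0 r0 (ltr0Sn _ _)).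
  near=> t.
  have h1 := le_lt_trans (hy s n) hn; have h2 := le_lt_trans (hy t n) hn.
  have h3 : `|Y n s - Y n t| < r / 3.
    near: t; apply: cvgr_dist_lt; first exact: Yc.
    by rewrite divr_gt0.
  have -> : y s - y t = (Y n s - Y n t) + ((Y n t - y t) - (Y n s - y s)).
    by rewrite addrA subrKA opprB addrC subrKA.
  apply: le_lt_trans (ler_normD _ _) _.
  have := ler_normB (Y n t - y t) (Y n s - y s); lra.
(* [T] halves distances, so [T (Y n)], which is [Y n.+1], tends to [T y] as well as to [y]. *)
have Ty : T y =1 y.
  move=> t; apply/eqP; rewrite -subr_eq0 -normr_le0; apply/ler_addgt0Pl => r r0.
  have [n hn] := small (r / 2) (divr_gt0 r0 (ltr0Sn _ _)).
  have Yy s : `|y s - Y n s| <= D / 2 ^+ n by rewrite distrC.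
  have h1 := Tctr _ _ _ yc (Yc n) Yy t.
  have h2 := hy t n.+1; rewrite exprS invfM mulrCA mulrC in h2.
  rewrite addr0 -(subrKA (T (Y n) t)); apply: le_trans (ler_normD _ _) _.
  move: h2; rewrite -[T (Y n) t]/(Y n.+1 t); lra.
exists d => //; exists y.
  rewrite -Ty /T clamp_id ?normr0 ?ltW// vprimitive0 addr0 //.
move=> t td; have t1 := lt_trans td d1.
have := is_deriveD (is_derive_cst y0 t 1) (is_derive_vprimitive (fyc _ yc) t1).
rewrite add0r; apply: near_eq_is_derive.
near=> s; rewrite -[RHS]Ty /T clamp_id//; apply: ltW; near: s.
have : open [set s : R | `|s| < d].
  rewrite (_ : [set _ | _] = ball (0 : R) d); first exact: ball_open.
  by apply/seteqP; split=> s; rewrite -ball_normE /ball_/= sub0r normrN.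
by move=> o; apply: (open_nbhs_nbhs (conj o td)).
Unshelve. all: by end_near. Qed.

(** Continuity at [y0] bounds the derivatives along the frame by [B + 1] on a ball; the ball is
    convex, so [frame_mvt] applies to the segment from [y] to [x]. *)
Lemma is_derive_lipschitz (f : V -> V) (y0 : V) (r : R) : 0 < r ->
  (forall x, `|x - y0| < r -> differentiable f x) ->
  (forall i, {for y0, continuous ('D_(e i) f)}) ->
  exists2 d : R, 0 < d & exists2 K : R, 0 <= K &
    forall x y, `|x - y0| < d -> `|y - y0| < d -> `|f x - f y| <= K * `|x - y|.
Proof.
move=> r0 df Dc; have [c c0 hc] := frame_coord_bound fr.
have [C C0 hC] := frame_mvt fr.
have [B B0 hB] : exists2 B, 0 <= B & forall i, `|'D_(e i) f y0| <= B.
  exists (\sum_i `|'D_(e i) f y0|); first exact: sumr_ge0.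
  by move=> i; rewrite (bigD1 i)//= lerDl sumr_ge0.
have : \forall x \near y0, forall i, `|'D_(e i) f x| <= B + 1.
  apply: filter_forall => i; near=> x.
  have -> : 'D_(e i) f x = 'D_(e i) f y0 - ('D_(e i) f y0 - 'D_(e i) f x).
    by rewrite opprB addrC subrK.
  apply: le_trans (ler_normB _ _) _; apply: lerD (hB i) _; apply: ltW; near: x.
  by apply: cvgr_dist_lt; first exact: Dc.
move=> /nbhs_ballP[d0 /= d00 hd].
pose d := Num.min d0 r; have dp : 0 < d by rewrite lt_min d00.
exists d => //.
exists (C * (c * (B + 1) * #|I|%:R)).
  by rewrite mulr_ge0 ?(ltW C0)// mulr_ge0// mulr_ge0 ?(ltW c0)// addr_ge0.
move=> x y xd yd.
pose z (s : R) := y + s *: (x - y).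
have zd s : 0 <= s <= 1 -> `|z s - y0| < d.
  move=> /andP[s0 s1].
  rewrite /z; have -> : y + s *: (x - y) - y0 = s *: (x - y0) + (1 - s) *: (y - y0).
    have -> : x - y = x - y0 - (y - y0) by rewrite opprB addrA subrK.
    by rewrite scalerBr scalerBl scale1r addrAC addrCA.
  apply: le_lt_trans (ler_normD _ _) _; rewrite !normrZ.
  rewrite (ger0_norm s0) ger0_norm ?subr_ge0//.
  have md : Num.max `|x - y0| `|y - y0| < d by rewrite gt_max xd.
  apply: le_lt_trans md.
  have h1 : s * `|x - y0| <= s * Num.max `|x - y0| `|y - y0|.
    by rewrite ler_wpM2l// le_max lexx.
  have h2 : (1 - s) * `|y - y0| <= (1 - s) * Num.max `|x - y0| `|y - y0|.
    by rewrite ler_wpM2l ?subr_ge0// le_max lexx orbT.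
  by lra.
have := hC (f \o z) (fun s => 'D_(x - y) f (z s)) ((c * (B + 1) * #|I|%:R) * `|x - y|).
rewrite /= /z scale1r scale0r addr0 [y + _]addrC subrK mulrA; apply=> s s01.
have zs := zd _ s01; rewrite lt_min in zs; case/andP: zs => zs1 zs2.
have dfz := df _ zs2; split.
  by apply: is_derive_comp dfz; exact: is_derive_line.
have -> : 'D_(x - y) f (z s) = \sum_i l i (x - y) *: 'D_(e i) f (z s).
  by rewrite [in LHS](fr.2 (x - y)) derive_sumdir.
apply: le_trans (ler_norm_sum _ _ _) _.
apply: (@le_trans _ _ (\sum_(i : I) c * `|x - y| * (B + 1))).
  apply: ler_sum => i _; rewrite normrZ; apply: ler_pM => //.
  by apply: hd; rewrite -ball_normE /ball_/= distrC.
rewrite sumr_const -[X in X <= _]mulr_natr; by rewrite le_eqVlt; apply/orP; left; apply/eqP; ring.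
Unshelve. all: by end_near. Qed.

(* Clamping the coordinates around y0 turns f into a globally Lipschitz field. *)
Lemma ode_local (f : V -> V) (y0 : V) (r : R) : 0 < r ->
  (forall x, `|x - y0| < r -> differentiable f x) ->
  (forall i, {for y0, continuous ('D_(e i) f)}) ->
  exists2 d : R, 0 < d & exists2 y : R -> V, y 0 = y0 &
    forall t : R, `|t| < d -> is_derive t 1 y (f (y t)).
Proof.
move=> r0 df Dc; have [d d0 [K K0 fK]] := is_derive_lipschitz r0 df Dc.
have [c c0 hc] := frame_coord_bound fr.
have N0 := frame_size_gt0 e; set N := frame_size e in N0.
(* Clamping the coordinates at [m] keeps [rho v] within m N = d / 2 of [y0], inside the ball where
   [f] is Lipschitz. *)
pose m := d / (2 * N).
have m0 : 0 < m by rewrite divr_gt0// mulr_gt0.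
pose rho v := y0 + \sum_i clamp m (l i (v - y0)) *: e i.
have rhod v : `|rho v - y0| < d.
  rewrite /rho addrC addKr.
  apply: (@le_lt_trans _ _ (m * N)).
    by apply: frame_sum_bound; [exact: ltW|move=> i; apply: clamp_le; exact: ltW].
  by rewrite /m invfM mulrA mulfVK ?gt_eqF// ltr_pdivrMr// mulr_natr mulr2n ltrDl.
have rhoK v w : `|rho v - rho w| <= c * `|v - w| * N.
  rewrite /rho opprD addrACA subrr add0r -sumrB.
  under eq_bigr do rewrite -scalerBl.
  apply: frame_sum_bound; first by rewrite mulr_ge0// ltW.
  move=> i; apply: le_trans (clamp_lipschitz _ _ (ltW m0)) _.
  by rewrite -linearB opprB addrA subrK; exact: hc.
have rho_id v : c * `|v - y0| <= m -> rho v = v.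
  move=> h; rewrite /rho; under eq_bigr.
    move=> i _; rewrite clamp_id; last exact: le_trans (hc _ _) h.
    over.
  by rewrite -(fr.2) addrC subrK.
have [||d1 d10 [y yy0 hy]] := @ode_lipschitz (f \o rho) (K * (c * N)) y0.
- by rewrite !mulr_ge0// ltW.
- move=> v w /=; apply: le_trans (fK _ _ (rhod _) (rhod _)) _.
  rewrite -mulrA ler_wpM2l//; apply: le_trans (rhoK _ _) _.
  by rewrite mulrAC.
(* By continuity [y] stays for a short time where [rho] is the identity, and there it solves the
   original equation. *)
have yc : {for (0 : R), continuous y}.
  have [|h _] := hy 0; first by rewrite normr0.
  exact/differentiable_continuous/derivable1_diffP.
have : \forall t \near (0 : R), `|y 0 - y t| < m / c.
  by move/cvgrPdist_lt : yc; apply; rewrite divr_gt0.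
move=> /nbhs_ballP[d2 /= d20 hd2].
exists (Num.min d1 d2); first by rewrite lt_min d10.
exists y => // t; rewrite lt_min => /andP[td1 td2].
have := hy t td1; rewrite /= rho_id//.
rewrite mulrC -ler_pdivlMr// -yy0 distrC; apply/ltW/hd2.
by rewrite -ball_normE /ball_/= sub0r normrN.
Qed.

(** Bootstrap: the derivative of [y] is [f \o y], of class C^k as soon as [y] is. *)
Lemma ode_smooth (f : V -> V) (y : R -> V) (J : set R) (U : set V) :
  open J -> smooth_on U f -> (forall t, J t -> U (y t)) ->
  (forall t : R, J t -> is_derive t 1 y (f (y t))) -> smooth_on J y.
Proof.
move=> oJ sf yU hy; have dy t : J t -> differentiable y t.
  by move=> /hy[/derivable1_diffP].
elim=> [|k IH]; first by move=> t /dy/differentiable_continuous.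
split=> // v; apply: (@Ck_ext _ _ _ _ _ (fun t => v *: f (y t))) => //.
  move=> t Jt; rewrite -[X in derive _ _ X]mulr1 -[v * 1]/(v *: (1 : R)).
  by rewrite deriveZdir; [have [_ ->] := hy _ Jt|exact: dy].
apply: (CkZ oJ (Ck_cst _ _ _)).
exact: (Ck_comp fr oJ yU IH (sf k)).
Qed.

End ODE.

(** * Homogeneous functions on the slit tangent bundle of a chart *)

Section SmoothOn.
Variable R : realType.
Implicit Types (V W : normedModType R).

Lemma smooth_diff V W (A : set V) (f : V -> W) x :
  smooth_on A f -> A x -> differentiable f x.
Proof. by move=> sf; exact: (sf 1%N).1. Qed.

Lemma smooth_derive V W (A : set V) (f : V -> W) v :
  smooth_on A f -> smooth_on A ('D_v f).
Proof. by move=> sf k; exact: (sf k.+1).2. Qed.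

Lemma smoothD V W (A : set V) (f g : V -> W) : open A ->
  smooth_on A f -> smooth_on A g -> smooth_on A (fun x => f x + g x).
Proof. by move=> oA sf sg k; exact: CkD. Qed.

Lemma smoothN V W (A : set V) (f : V -> W) : open A ->
  smooth_on A f -> smooth_on A (fun x => - f x).
Proof. by move=> oA sf k; exact: CkN. Qed.

Lemma smoothM V (A : set V) (f g : V -> R) : open A ->
  smooth_on A f -> smooth_on A g -> smooth_on A (fun x => f x * g x).
Proof. by move=> oA sf sg k; exact: CkM. Qed.

Lemma smoothZ V W (A : set V) (a : V -> R) (f : V -> W) : open A ->
  smooth_on A a -> smooth_on A f -> smooth_on A (fun x => a x *: f x).
Proof. by move=> oA sf sg k; exact: CkZ. Qed.

Lemma smoothV V (A : set V) (f : V -> R) : open A ->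
  (forall x, A x -> f x != 0) -> smooth_on A f ->
  smooth_on A (fun x => (f x)^-1).
Proof. by move=> oA f0 sf k; exact: CkV. Qed.

Lemma smooth_cst V W (A : set V) (a : W) : smooth_on A (fun=> a).
Proof. by move=> k; exact: Ck_cst. Qed.

Lemma smooth_continuous V W (A : set V) (f : V -> W) x :
  smooth_on A f -> A x -> {for x, continuous f}.
Proof. by move=> sf; exact: (sf 0%N). Qed.

End SmoothOn.

Section Coordinates.
Variables (R : realType) (n : nat).

Definition row_coord (i : 'I_n) (v : 'rV[R]_n) : R := v 0 i.

Lemma row_coord_linear i : linear (row_coord i).
Proof. by move=> a u v; rewrite /row_coord !mxE. Qed.

HB.instance Definition _ i :=
  GRing.isLinear.Build R 'rV[R]_n R _ (row_coord i) (row_coord_linear i).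

Lemma row_coord_continuous i : continuous (row_coord i).
Proof. exact: coord_continuous. Qed.

Definition pair_coord (i : 'I_n + 'I_n) (z : 'rV[R]_n * 'rV[R]_n) : R :=
  match i with inl i => z.1 0 i | inr i => z.2 0 i end.

Lemma pair_coord_linear i : linear (pair_coord i).
Proof. by case: i => i a u v; rewrite /pair_coord !mxE. Qed.

HB.instance Definition _ i :=
  GRing.isLinear.Build R ('rV[R]_n * 'rV[R]_n)%type R _ (pair_coord i)
    (pair_coord_linear i).

Lemma pair_coord_continuous i : continuous (pair_coord i).
Proof.
case: i => i z.
  apply: (@continuous_comp _ _ _ (@fst _ _) (row_coord i)); first exact: cvg_fst.
  exact: row_coord_continuous.
apply: (@continuous_comp _ _ _ (@snd _ _) (row_coord i)); first exact: cvg_snd.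
exact: row_coord_continuous.
Qed.

Definition row_basis (i : 'I_n) : 'rV[R]_n := delta_mx 0 i.

Definition pair_basis (i : 'I_n + 'I_n) : 'rV[R]_n * 'rV[R]_n :=
  match i with inl i => (delta_mx 0 i, 0) | inr i => (0, delta_mx 0 i) end.

Lemma row_frame : frame row_basis (fun i => row_coord i).
Proof.
by split=> [i|v]; [exact: row_coord_continuous|exact: row_sum_delta].
Qed.

Lemma pair_frame : frame pair_basis (fun i => pair_coord i).
Proof.
split=> [i|[u v]]; first exact: pair_coord_continuous.
have fstS (J : finType) (F : J -> 'rV[R]_n * 'rV[R]_n) :
    (\sum_j F j).1 = \sum_j (F j).1 by exact: (big_morph fst).
have sndS (J : finType) (F : J -> 'rV[R]_n * 'rV[R]_n) :
    (\sum_j F j).2 = \sum_j (F j).2 by exact: (big_morph snd).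
apply: injective_projections; rewrite ?fstS ?sndS big_sumType/=.
  rewrite [X in _ + X]big1 ?addr0; first exact: row_sum_delta.
  by move=> i _; rewrite scaler0.
rewrite big1 ?add0r; first exact: row_sum_delta.
by move=> i _; rewrite scaler0.
Qed.

End Coordinates.

Section Homogeneity.
Variables (R : realType) (n : nat) (D : set 'rV[R]_n).
Hypothesis oD : open D.
Implicit Types (z : 'rV[R]_n * 'rV[R]_n) (h : 'rV[R]_n * 'rV[R]_n -> R).

Definition slit_over : set ('rV[R]_n * 'rV[R]_n) := [set z | D z.1 /\ z.2 != 0].

Lemma slit_over_open : open slit_over.
Proof.
rewrite (_ : slit_over = fst @^-1` D `&` (fun z => `|z.2|) @^-1` [set x | 0 < x]).
  apply: openI; apply: open_comp => //.
  - by move=> z _; exact: cvg_fst.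
  - move=> z _; apply: continuous_comp; first exact: cvg_snd.
    exact: norm_continuous.
by apply/seteqP; split=> z [Dz]; rewrite /= ?normr_gt0.
Qed.

Lemma derive_coords h z u v : differentiable h z ->
  'D_(u, v) h z = \sum_i u 0 i * dx i h z + \sum_i v 0 i * dxi i h z.
Proof.
move=> dh; rewrite [in LHS]((pair_frame R n).2 (u, v)) derive_sumdir//.
by rewrite big_sumType.
Qed.

Lemma is_derive_fiber z (s : R) :
  is_derive s 1 (fun s : R => (z.1, s *: z.2)) (0, z.2).
Proof.
have := is_derive_line (z.1, 0) (0, z.2) s; apply: near_eq_is_derive.
by near=> t; apply: injective_projections; rewrite /= ?scaler0 ?addr0 ?add0r.
Unshelve. all: by end_near. Qed.

Lemma slit_over_scale z a : slit_over z -> 0 < a -> slit_over (z.1, a *: z.2).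
Proof. by move=> [? z2] a0; split=> //=; rewrite scaler_eq0 negb_or gt_eqF. Qed.

(** Chain rule for the linear map (x, xi) |-> (x, a xi). It scales fiber directions by [a] and
    leaves base directions alone, so a fiber derivative lowers the degree of homogeneity by one and
    a base derivative preserves it. *)
Lemma derive_homogeneous h (m a : R) z u v : 0 < a -> slit_over z ->
  (forall z, slit_over z -> differentiable h z) ->
  (forall z, slit_over z -> h (z.1, a *: z.2) = m * h z) ->
  'D_(u, a *: v) h (z.1, a *: z.2) = m * 'D_(u, v) h z.
Proof.
move=> a0 Uz dh hh.
pose A (w : 'rV[R]_n * 'rV[R]_n) := (w.1, a *: w.2).
have Al : linear A 
  by move=> b w w'; apply: injective_projections; rewrite //= scalerDr !scalerA mulrC.
pose AL : {linear _ -> _} := HB.pack A (GRing.isLinear.Build _ _ _ _ A Al).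
have Ac : continuous AL.
  move=> w; have c2 : a *: x.2 @[x --> w] --> a *: w.2.
    by apply: cvgZ; [exact: cvg_cst|exact: cvg_snd].
  have c1 : x.1 @[x --> w] --> w.1 by exact: cvg_fst.
  exact: (cvg_pair c1 c2).
have dA : differentiable A z by exact: (@linear_differentiable _ _ _ AL).
have dhA : differentiable h (A z) by apply: dh; exact: slit_over_scale.
have DA : 'D_(u, v) A z = (u, a *: v) by exact: (@derive_linfun _ _ _ AL).
have := derive_comp (u, v) dA dhA; rewrite DA => <-.
have -> : m * 'D_(u, v) h z = 'D_(u, v) (fun z => m * h z) z.
  by rewrite (@deriveZ _ _ _ h)//; exact/diff_derivable/dh.
apply: near_eq_derive.
by apply: filterS (open_nbhs_nbhs (conj slit_over_open Uz)) => w /hh.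
Qed.

(** Euler's identity, by differentiating the homogeneity relation in [a] at 1; [euler0] is the same
    in degree 0. *)
Lemma euler1 h z : slit_over z -> differentiable h z ->
  (forall a, 0 < a -> h (z.1, a *: z.2) = a * h z) -> 'D_(0, z.2) h z = h z.
Proof.
move=> Uz dh hh.
have dz : differentiable h (z.1, 1 *: z.2) by rewrite scale1r -surjective_pairing.
have [_] := is_derive_comp (is_derive_fiber z 1) dz.
rewrite scale1r -surjective_pairing => <-.
have -> : h z = 'D_1 (fun a : R => a * h z) 1.
  rewrite (@derive_scale _ _ _ id (cst (h z)))// derive_id derive_cst.
  by rewrite scaler0 addr0 -[LHS]mul1r.
apply: near_eq_derive; have : \forall a \near (1 : R), 0 < a by exact: lt_nbhsr.
by apply: filterS => a /hh.
Qed.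

Lemma euler0 h z : slit_over z -> differentiable h z ->
  (forall a, 0 < a -> h (z.1, a *: z.2) = h z) -> 'D_(0, z.2) h z = 0.
Proof.
move=> Uz dh hh.
have dz : differentiable h (z.1, 1 *: z.2) by rewrite scale1r -surjective_pairing.
have [_] := is_derive_comp (is_derive_fiber z 1) dz.
rewrite scale1r -surjective_pairing => <-.
rewrite -(derive_cst (h z) (1 : R) 1).
apply: near_eq_derive; have : \forall a \near (1 : R), 0 < a by exact: lt_nbhsr.
by apply: filterS => a /hh.
Qed.

End Homogeneity.

Lemma sum_ord2 (V : nmodType) (F : 'I_2 -> V) : \sum_i F i = F 0 + F 1.
Proof.
rewrite !big_ord_recl big_ord0 addr0; congr (_ + F _); exact: val_inj.
Qed.

Lemma forall_ord2 (P : 'I_2 -> Prop) : P 0 -> P 1 -> forall i, P i.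
Proof.
move=> P0 P1 [[|[|//]] h].
  by rewrite (_ : Ordinal h = 0)//; exact: val_inj.
by rewrite (_ : Ordinal h = 1)//; exact: val_inj.
Qed.

Section Partials.
Variables (R : realType) (n : nat).
Implicit Types (z : 'rV[R]_n * 'rV[R]_n) (f : 'rV[R]_n * 'rV[R]_n -> R).

(* Locked copies of dx and dxi: the unifier otherwise unfolds derivatives
   whenever it compares partial derivatives in different directions. *)
Definition pdx (i : 'I_n) := locked (@dx R n) i.
Definition pdxi (i : 'I_n) := locked (@dxi R n) i.

Lemma pdxE : pdx = @dx R n. Proof. by rewrite /pdx -lock. Qed.
Lemma pdxiE : pdxi = @dxi R n. Proof. by rewrite /pdxi -lock. Qed.

Lemma smooth_pdx (A : set _) i f : smooth_on A f -> smooth_on A (pdx i f).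
Proof. rewrite pdxE; exact: smooth_derive. Qed.

Lemma smooth_pdxi (A : set _) i f : smooth_on A f -> smooth_on A (pdxi i f).
Proof. rewrite pdxiE; exact: smooth_derive. Qed.

Lemma pdxiC (A : set _) i j f z : open A -> smooth_on A f -> A z ->
  pdxi i (pdxi j f) z = pdxi j (pdxi i f) z.
Proof. rewrite pdxiE; exact: smooth_schwarz. Qed.

Lemma pdx_pdxiC (A : set _) i j f z : open A -> smooth_on A f -> A z ->
  pdx i (pdxi j f) z = pdxi j (pdx i f) z.
Proof. rewrite pdxE pdxiE; exact: smooth_schwarz. Qed.

Lemma near_eq_pdx i f g z : (\near z, f z = g z) -> pdx i f z = pdx i g z.
Proof. rewrite pdxE; exact: near_eq_derive. Qed.

Lemma near_eq_pdxi i f g z : (\near z, f z = g z) -> pdxi i f z = pdxi i g z.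
Proof. rewrite pdxiE; exact: near_eq_derive. Qed.

Lemma pdxM i f g z : differentiable f z -> differentiable g z ->
  pdx i (fun z => f z * g z) z = pdx i f z * g z + f z * pdx i g z.
Proof. rewrite pdxE; exact: derive_scale. Qed.

Lemma pdxiM i f g z : differentiable f z -> differentiable g z ->
  pdxi i (fun z => f z * g z) z = pdxi i f z * g z + f z * pdxi i g z.
Proof. rewrite pdxiE; exact: derive_scale. Qed.

Lemma pdxZ i (a : R) f z : differentiable f z ->
  pdx i (fun z => a * f z) z = a * pdx i f z.
Proof.
move=> df; rewrite (pdxM i (differentiable_cst a z) df).
by rewrite (_ : pdx i (cst a) z = 0) ?mul0r ?add0r// pdxE; exact: derive_cst.
Qed.

Lemma pdxiZ i (a : R) f z : differentiable f z ->
  pdxi i (fun z => a * f z) z = a * pdxi i f z.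
Proof.
move=> df; rewrite (pdxiM i (differentiable_cst a z) df).
by rewrite (_ : pdxi i (cst a) z = 0) ?mul0r ?add0r// pdxiE; exact: derive_cst.
Qed.

Lemma pdxiB i f g z : differentiable f z -> differentiable g z ->
  pdxi i (fun z => f z - g z) z = pdxi i f z - pdxi i g z.
Proof.
by rewrite pdxiE => df dg; apply: deriveB; exact: diff_derivable.
Qed.

Lemma pdx_fiber i j z : pdx i (fun z => z.2 0 j) z = 0.
Proof.
rewrite pdxE /dx (derive_linfun _ _ (@pair_coord_continuous R n (inr j))).
by rewrite /pair_coord /= mxE.
Qed.

Lemma derive_partials f z u v : differentiable f z ->
  'D_(u, v) f z = \sum_i u 0 i * pdx i f z + \sum_i v 0 i * pdxi i f z.
Proof. by rewrite pdxE pdxiE; exact: derive_coords. Qed.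

Lemma derive_fiber_delta j f z : 'D_(0, delta_mx 0 j) f z = pdxi j f z.
Proof. by rewrite pdxiE. Qed.

Lemma derive_base_delta j f z : 'D_(delta_mx 0 j, 0) f z = pdx j f z.
Proof. by rewrite pdxE. Qed.

End Partials.

(** * Fiber Hessian and Euler-Lagrange expression of a 1-homogeneous function *)

Section FiberHessian.
Variables (R : realType) (D : set 'rV[R]_2).
Hypothesis oD : open D.
Implicit Types (z : 'rV[R]_2 * 'rV[R]_2) (f g h : 'rV[R]_2 * 'rV[R]_2 -> R).

Local Notation U := (slit_over D).
Let oU : open U := slit_over_open oD.

Definition hess_trace f z : R := pdxi 0 (pdxi 0 f) z + pdxi 1 (pdxi 1 f) z.

(* On the fibers the Hessian of a 1-homogeneous f is
   lam f * [[q^2, - p q], [- p q, p^2]] with (p, q) = xi. *)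
Definition lam f z : R := hess_trace f z / (z.2 0 0 ^+ 2 + z.2 0 1 ^+ 2).

(* The Euler-Lagrange expression of a 1-homogeneous f at a point (x, xi) with
   acceleration w is (tor f + lam f * (q w_0 - p w_1)) * (q, - p). *)
Definition tor f z : R := pdx 1 (pdxi 0 f) z - pdx 0 (pdxi 1 f) z.

Definition homogeneous1 f := forall z a, U z -> 0 < a ->
  f (z.1, a *: z.2) = a * f z.

Lemma fiber_norm_neq0 z : U z -> z.2 0 0 ^+ 2 + z.2 0 1 ^+ 2 != 0.
Proof.
move=> [_]; apply: contraNneq => h; apply/eqP/rowP; apply: forall_ord2; rewrite mxE.
  by apply/eqP; rewrite -(sqrf_eq0 (z.2 0 0)); apply/eqP; nra.
by apply/eqP; rewrite -(sqrf_eq0 (z.2 0 1)); apply/eqP; nra.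
Qed.

Lemma derive_coords2 h z u v : differentiable h z ->
  'D_(u, v) h z = u 0 0 * pdx 0 h z + u 0 1 * pdx 1 h z +
                  (v 0 0 * pdxi 0 h z + v 0 1 * pdxi 1 h z).
Proof. by move=> dh; rewrite derive_partials// !sum_ord2. Qed.

Lemma derive_fiber2 h z v : differentiable h z ->
  'D_(0, v) h z = v 0 0 * pdxi 0 h z + v 0 1 * pdxi 1 h z.
Proof.
have e i : (0 : 'rV[R]_2) 0 i = 0 by rewrite mxE.
by move=> dh; rewrite derive_coords2// !e !mul0r !add0r.
Qed.

Lemma smooth_fiber_coord i : smooth_on U (fun z => z.2 0 i).
Proof.
move=> k.
have h := @Ck_lin R k _ _ U (pair_coord (inr i) : {linear _ -> _})
  (@pair_coord_continuous R 2 (inr i)).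
exact: h.
Qed.

Lemma smooth_fiber_norm : smooth_on U (fun z => z.2 0 0 ^+ 2 + z.2 0 1 ^+ 2).
Proof.
by apply: (smoothD oU); apply: (smoothM oU) (@smooth_fiber_coord _) (@smooth_fiber_coord _).
Qed.

Lemma smooth_hess_trace f : smooth_on U f -> smooth_on U (hess_trace f).
Proof. by move=> sf; apply: (smoothD oU); do 2!apply: smooth_pdxi. Qed.

Lemma smooth_lam f : smooth_on U f -> smooth_on U (lam f).
Proof.
move=> sf; apply: (smoothM oU); first exact: smooth_hess_trace.
by apply: (smoothV oU); [exact: fiber_norm_neq0|exact: smooth_fiber_norm].
Qed.

Lemma smooth_tor f : smooth_on U f -> smooth_on U (tor f).
Proof.
move=> sf; apply: (smoothD oU); first exact/smooth_pdx/smooth_pdxi.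
by apply: (smoothN oU); exact/smooth_pdx/smooth_pdxi.
Qed.

Section OneHomogeneous.
Variable f : 'rV[R]_2 * 'rV[R]_2 -> R.
Hypotheses (sf : smooth_on U f) (hf : homogeneous1 f).

Let df z : U z -> differentiable f z := smooth_diff sf.

Lemma dxi_homogeneous i z a : U z -> 0 < a -> pdxi i f (z.1, a *: z.2) = pdxi i f z.
Proof.
move=> Uz a0; have /(_ _ Uz) := @derive_homogeneous _ _ _ oD f a a _ 0 (delta_mx 0 i) a0.
move=> /(_ df (fun z Uz => hf Uz a0)).
have Uaz := slit_over_scale Uz a0.
have -> : (0, a *: delta_mx 0 i) = a *: ((0, delta_mx 0 i) : 'rV[R]_2 * 'rV[R]_2).
  by apply: injective_projections; rewrite ?scaler0 /= ?scaler0.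
rewrite deriveZdir ?derive_fiber_delta; last exact: df.
by move/mulfI; apply; rewrite gt_eqF.
Qed.

Lemma dx_homogeneous i : homogeneous1 (pdx i f).
Proof.
move=> z a Uz a0.
have /(_ _ Uz) := @derive_homogeneous _ _ _ oD f a a _ (delta_mx 0 i) 0 a0.
by move=> /(_ df (fun z Uz => hf Uz a0)); rewrite scaler0 !derive_base_delta.
Qed.

Lemma dxi2_homogeneous i j z a : U z -> 0 < a ->
  a * pdxi j (pdxi i f) (z.1, a *: z.2) = pdxi j (pdxi i f) z.
Proof.
move=> Uz a0.
have di w : U w -> differentiable (pdxi i f) w by exact/smooth_diff/smooth_pdxi.
have dh w : U w -> pdxi i f (w.1, a *: w.2) = 1 * pdxi i f w.
  by move=> Uw; rewrite mul1r dxi_homogeneous.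
have E := derive_homogeneous oD 0 (delta_mx 0 j) a0 Uz di dh.
rewrite mul1r derive_fiber_delta in E; rewrite -[RHS]E.
have -> : (0, a *: delta_mx 0 j) = a *: ((0, delta_mx 0 j) : 'rV[R]_2 * 'rV[R]_2).
  by apply: injective_projections; rewrite ?scaler0 /= ?scaler0.
by rewrite deriveZdir ?derive_fiber_delta; last exact/di/slit_over_scale.
Qed.

Lemma euler_f z : U z -> z.2 0 0 * pdxi 0 f z + z.2 0 1 * pdxi 1 f z = f z.
Proof.
move=> Uz; rewrite -derive_fiber2; last exact: df.
by apply: (@euler1 _ _ D) => //; [exact: df|move=> a; exact: hf].
Qed.

Lemma euler_dx i z : U z ->
  z.2 0 0 * pdxi 0 (pdx i f) z + z.2 0 1 * pdxi 1 (pdx i f) z = pdx i f z.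
Proof.
have di w : U w -> differentiable (pdx i f) w by exact/smooth_diff/smooth_pdx.
move=> Uz; rewrite -derive_fiber2; last exact: di.
by apply: (@euler1 _ _ D) => //; [exact: di|move=> a; exact: dx_homogeneous].
Qed.

Lemma euler_dxi i z : U z ->
  z.2 0 0 * pdxi 0 (pdxi i f) z + z.2 0 1 * pdxi 1 (pdxi i f) z = 0.
Proof.
have di w : U w -> differentiable (pdxi i f) w by exact/smooth_diff/smooth_pdxi.
move=> Uz; rewrite -derive_fiber2; last exact: di.
by apply: (@euler0 _ _ D) => //; [exact: di|move=> a; exact: dxi_homogeneous].
Qed.

(** The derivatives [pdxi i f] have degree 0, so by Euler's identity the Hessian annihilates (p, q).
    A symmetric 2 x 2 matrix with this kernel is a multiple of the square of (q, - p), and its trace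
    gives the multiple. *)
Lemma hessE z : U z ->
  [/\ pdxi 0 (pdxi 0 f) z = lam f z * z.2 0 1 ^+ 2,
      pdxi 1 (pdxi 0 f) z = - (lam f z * (z.2 0 0 * z.2 0 1)),
      pdxi 0 (pdxi 1 f) z = - (lam f z * (z.2 0 0 * z.2 0 1)) &
      pdxi 1 (pdxi 1 f) z = lam f z * z.2 0 0 ^+ 2].
Proof.
move=> Uz; have n0 := fiber_norm_neq0 Uz.
have e0 := euler_dxi 0 Uz; have e1 := euler_dxi 1 Uz.
have s01 := pdxiC 0 1 oU sf Uz.
rewrite /lam /hess_trace s01 in e1 *.
move: (pdxi 0 (pdxi 0 f) z) (pdxi 1 (pdxi 0 f) z) (pdxi 1 (pdxi 1 f) z) e0 e1 n0 => a b c.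
move: (z.2 0 0) (z.2 0 1) => p q e0 e1 n0.
have solve x y r : x * (p ^+ 2 + q ^+ 2) - y * r = 0 -> x = y / (p ^+ 2 + q ^+ 2) * r.
  by move/eqP; rewrite subr_eq0 => /eqP E; apply: (mulIf n0); rewrite E; field.
split.
- apply: solve; transitivity (p * (p * a + q * b) - q * (p * b + q * c)); first by ring.
  by rewrite e0 e1; ring.
- rewrite -mulrN; apply: solve.
  transitivity (q * (p * a + q * b) + p * (p * b + q * c)); first by ring.
  by rewrite e0 e1; ring.
- rewrite -mulrN; apply: solve.
  transitivity (q * (p * a + q * b) + p * (p * b + q * c)); first by ring.
  by rewrite e0 e1; ring.
- apply: solve; transitivity (q * (p * b + q * c) - p * (p * a + q * b)); first by ring.
  by rewrite e0 e1; ring.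
Qed.

(** The part in [w] is read from [hessE]. In the remaining part, Euler's identity for the
    1-homogeneous [pdx i f] writes the subtracted term as a combination of mixed derivatives; only
    their skew part [tor f] survives. *)
Lemma euler_lagrange1 z (w : 'rV[R]_2) : U z ->
  forall i, 'D_(z.2, w) (pdxi i f) z - pdx i f z =
    (tor f z + lam f z * (z.2 0 1 * w 0 0 - z.2 0 0 * w 0 1)) *
    (if i == 0 then z.2 0 1 else - z.2 0 0).
Proof.
move=> Uz; have [h00 h01 h10 h11] := hessE Uz.
have di i : differentiable (pdxi i f) z by exact: smooth_diff (smooth_pdxi i sf) Uz.
have E0 := euler_dx 0 Uz; have E1 := euler_dx 1 Uz.
rewrite -!(pdx_pdxiC _ _ oU sf Uz) in E0 E1.
apply: forall_ord2 => /=; rewrite derive_coords2//.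
  by rewrite h00 h01 -E0 /tor; ring.
by rewrite h10 h11 -E1 /tor; ring.
Qed.

(** Commuting the derivatives turns the left side into base derivatives of Hessian entries; by
    [hessE] these are [lam f] times monomials in p and q, which base derivatives treat as
    constants. *)
Lemma dxi_tor z : U z -> forall i,
  pdxi i (tor f) z = (if i == 0 then z.2 0 1 else - z.2 0 0) *
    (z.2 0 0 * pdx 0 (lam f) z + z.2 0 1 * pdx 1 (lam f) z).
Proof.
move=> Uz.
have s1 i : smooth_on U (pdxi i f) by exact: smooth_pdxi.
have sd i j : differentiable (pdx i (pdxi j f)) z by apply: (smooth_diff _ Uz); exact: smooth_pdx.
have dl : differentiable (lam f) z by apply: (smooth_diff _ Uz); exact: smooth_lam.
have nU (P : _ -> Prop) : (forall z, U z -> P z) -> \forall w \near z, P w.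
  by move=> h; apply: filterS (open_nbhs_nbhs (conj oU Uz)).
have dE i : pdxi i (tor f) z = pdxi i (pdx 1 (pdxi 0 f)) z - pdxi i (pdx 0 (pdxi 1 f)) z.
  exact: pdxiB.
have sw i j k : pdxi i (pdx j (pdxi k f)) z = pdx j (pdxi i (pdxi k f)) z.
  by symmetry; exact: pdx_pdxiC oU (s1 k) Uz.
have ddc (j : 'I_2) : differentiable (fun z : 'rV[R]_2 * 'rV[R]_2 => z.2 0 j) z.
  by apply: (smooth_diff _ Uz); exact: smooth_fiber_coord.
have key (i j k : 'I_2) (s : R) :
   pdx i (fun z => s * (lam f z * (z.2 0 j * z.2 0 k))) z =
     s * (pdx i (lam f) z * (z.2 0 j * z.2 0 k)).
  have d2 : differentiable (fun z : 'rV[R]_2 * 'rV[R]_2 => z.2 0 j * z.2 0 k) z.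
    exact: differentiableM.
  have d3 : differentiable (fun z => lam f z * (z.2 0 j * z.2 0 k)) z.
    exact: differentiableM.
  rewrite (pdxZ i s d3) (pdxM i dl d2) pdxM// !pdx_fiber.
  by rewrite !(mul0r, mulr0, addr0).
have c00 i : pdx i (pdxi 0 (pdxi 0 f)) z = pdx i (lam f) z * (z.2 0 1 * z.2 0 1).
  rewrite -[RHS]mul1r -key; apply: near_eq_pdx; apply: nU => w Uw.
  by have [-> _ _ _] := hessE Uw; rewrite mul1r.
have c11 i : pdx i (pdxi 1 (pdxi 1 f)) z = pdx i (lam f) z * (z.2 0 0 * z.2 0 0).
  rewrite -[RHS]mul1r -key; apply: near_eq_pdx; apply: nU => w Uw.
  by have [_ _ _ ->] := hessE Uw; rewrite mul1r.
have c01 i : pdx i (pdxi 0 (pdxi 1 f)) z = - (pdx i (lam f) z * (z.2 0 0 * z.2 0 1)).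
  rewrite -[RHS]mulN1r -key; apply: near_eq_pdx; apply: nU => w Uw.
  by have [_ _ -> _] := hessE Uw; rewrite mulN1r.
have c10 i : pdx i (pdxi 1 (pdxi 0 f)) z = - (pdx i (lam f) z * (z.2 0 0 * z.2 0 1)).
  rewrite -[RHS]mulN1r -key; apply: near_eq_pdx; apply: nU => w Uw.
  by have [_ -> _ _] := hessE Uw; rewrite mulN1r.
apply: forall_ord2 => /=; rewrite dE !sw ?c00 ?c01 ?c10 ?c11; ring.
Qed.

End OneHomogeneous.
End FiberHessian.

Lemma Ck_pair (R : realType) k (V W W' : normedModType R) (A : set V)
    (f : V -> W) (g : V -> W') : open A ->
  Ck_on k A f -> Ck_on k A g -> Ck_on k A (fun x => (f x, g x)).
Proof.
move=> oA; elim: k f g => [|k IH] f g.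
  by move=> /= fc gc x Ax; have h1 := fc x Ax; have h2 := gc x Ax; exact: (cvg_pair h1 h2).
move=> [df Df] [dg Dg]; split=> [x Ax|v].
  by apply: differentiable_pair; [exact: df|exact: dg].
apply: (@Ck_ext _ _ _ _ _ (fun x => ('D_v f x, 'D_v g x))) => //; last exact: IH (Df v) (Dg v).
move=> x Ax; have dfx := df x Ax; have dgx := dg x Ax.
by rewrite !deriveE//; [rewrite diff_pair|exact: differentiable_pair].
Qed.

(** * Positivity and the geodesic equation of a Finsler metric in one chart *)

Section Finsler.
Variables (R : realType) (D : set 'rV[R]_2).
Hypothesis oD : open D.
Implicit Types (z : 'rV[R]_2 * 'rV[R]_2).

Local Notation U := (slit_over D).
Let oU : open U := slit_over_open oD.

Variable f : 'rV[R]_2 * 'rV[R]_2 -> R.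
Hypotheses (sf : smooth_on U f) (hf : homogeneous1 D f).

Let df z : U z -> differentiable f z := smooth_diff sf.
Let ddxi i z : U z -> differentiable (pdxi i f) z.
Proof. exact/smooth_diff/smooth_pdxi. Qed.

Let nU (P : _ -> Prop) z : U z -> (forall z, U z -> P z) -> \forall w \near z, P w.
Proof. by move=> Uz h; apply: filterS (open_nbhs_nbhs (conj oU Uz)). Qed.

(** Convertible to [energy F phi] when [f] is [local F phi]. *)
Definition half_square z : R := 2^-1 * f z ^+ 2.

Lemma pdxi_half_square i z : U z -> pdxi i half_square z = f z * pdxi i f z.
Proof.
move=> Uz; have h := pdxiM i (df Uz) (df Uz).
have d2 : differentiable (fun z => f z * f z) z by exact: differentiableM (df Uz) (df Uz).
rewrite /half_square (pdxiZ i 2^-1 d2) h.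
by field.
Qed.

Lemma pdx_half_square i z : U z -> pdx i half_square z = f z * pdx i f z.
Proof.
move=> Uz; have h := pdxM i (df Uz) (df Uz).
have d2 : differentiable (fun z => f z * f z) z by exact: differentiableM (df Uz) (df Uz).
rewrite /half_square (pdxZ i 2^-1 d2) h.
by field.
Qed.

Lemma pdxi2_half_square i j z : U z -> pdxi j (pdxi i half_square) z =
  pdxi j f z * pdxi i f z + f z * pdxi j (pdxi i f) z.
Proof.
move=> Uz; rewrite (@near_eq_pdxi _ _ _ _ (fun z => f z * pdxi i f z)).
  exact: pdxiM (df Uz) (ddxi i Uz).
by apply: nU Uz _ => w Uw; exact: pdxi_half_square.
Qed.

Lemma smooth_half_square : smooth_on U half_square.
Proof. by apply: (smoothM oU (smooth_cst _ _)); exact: smoothM. Qed.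

Section Positivity.
Hypothesis f_ge0 : forall z, 0 <= f z.
Hypothesis f_pos : forall z, U z ->
  positive_definite (2^-1 *: fiber_hessian (fun w => f w ^+ 2) z).

(** The Hessian of f^2 / 2 is the square of the fiber differential of [f] plus [f] times the Hessian
    of [f], and the latter has rank at most one by [hessE]. *)
Lemma fundamental_tensor_quadratic z (v : 'rV[R]_2) : U z ->
  (v *m (2^-1 *: fiber_hessian (fun w => f w ^+ 2) z) *m v^T) 0 0 =
  (v 0 0 * pdxi 0 f z + v 0 1 * pdxi 1 f z) ^+ 2 +
  f z * (lam f z * (z.2 0 1 * v 0 0 - z.2 0 0 * v 0 1) ^+ 2).
Proof.
move=> Uz.
have E i j : (2^-1 *: fiber_hessian (fun w => f w ^+ 2) z) i j =
    pdxi j f z * pdxi i f z + f z * pdxi j (pdxi i f) z.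
  rewrite !mxE -pdxi2_half_square// -pdxiE.
  have d2 w : U w -> differentiable (fun w => f w ^+ 2) w.
    by move=> Uw; apply: differentiableM (df Uw) (df Uw).
  have E1 w : U w -> pdxi i half_square w = 2^-1 * pdxi i (fun w => f w ^+ 2) w.
    by move=> Uw; exact: pdxiZ (d2 _ Uw).
  rewrite (@near_eq_pdxi _ _ _ _ _ _ (nU Uz E1)).
  have d3 : differentiable (pdxi i (fun w => f w ^+ 2)) z.
    by apply: (smooth_diff _ Uz); apply: smooth_pdxi; exact: smoothM.
  exact: (esym (pdxiZ j 2^-1 d3)).
have [h00 h01 h10 h11] := hessE oD sf hf Uz.
rewrite mxE sum_ord2 !mxE !sum_ord2 !E h00 h01 h10 h11.
by move: (pdxi 0 f z) (pdxi 1 f z) => a b; ring.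
Qed.

(** On v = xi the Hessian term vanishes and Euler's identity makes the form equal to f^2. *)
Lemma finsler_gt0 z : U z -> 0 < f z.
Proof.
move=> Uz; rewrite lt_neqAle f_ge0 andbT eq_sym.
have := f_pos Uz Uz.2; rewrite fundamental_tensor_quadratic// (euler_f sf hf Uz).
have -> : z.2 0 1 * z.2 0 0 - z.2 0 0 * z.2 0 1 = 0 by ring.
by rewrite expr0n/= !mulr0 addr0 exprn_even_gt0.
Qed.

(** The form is tested on v = (f_q, - f_p), with f_p and f_q the fiber derivatives. It lies in the
    kernel of the fiber differential, and q v_0 - p v_1 = f by Euler's identity, so the value is lam
    f * f^3. *)
Lemma lam_gt0 z : U z -> 0 < lam f z.
Proof.
move=> Uz; have f0 := finsler_gt0 Uz.
pose v : 'rV[R]_2 := pdxi 1 f z *: delta_mx 0 0 - pdxi 0 f z *: delta_mx 0 1.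
have v0 : v 0 0 = pdxi 1 f z by rewrite !mxE/= mulr1 mulr0 subr0.
have v1 : v 0 1 = - pdxi 0 f z by rewrite !mxE/= mulr1 mulr0 sub0r.
have ev : z.2 0 1 * v 0 0 - z.2 0 0 * v 0 1 = f z.
  by rewrite v0 v1 -(euler_f sf hf Uz); ring.
have vn0 : v != 0.
  by apply: contraTneq f0 => v00; rewrite -ev v00 !mxE !mulr0 subr0 ltxx.
have := f_pos Uz vn0; rewrite fundamental_tensor_quadratic// ev v0 v1.
have -> : pdxi 1 f z * pdxi 0 f z + - pdxi 0 f z * pdxi 1 f z = 0 by ring.
rewrite expr0n/= add0r pmulr_rgt0// pmulr_lgt0// exprn_gt0//.
Qed.

End Positivity.

Section Spray.
Hypothesis f0 : forall z, U z -> f z != 0.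
Hypothesis l0 : forall z, U z -> lam f z != 0.

(** The Euler-Lagrange covector of f^2 / 2 is F times the fiber differential of [f] plus f K (q, -
    p). Pairing with xi kills the second term and leaves F f = 0; pairing the rest with (q, - p)
    gives K = 0. So K = 0 is the equation of the unparametrized curve and F = 0 says that [f] is
    constant along it. *)
Lemma euler_lagrange2P z (w : 'rV[R]_2) : U z ->
  (forall i, 'D_(z.2, w) (pdxi i half_square) z = pdx i half_square z) <->
  (tor f z + lam f z * (z.2 0 1 * w 0 0 - z.2 0 0 * w 0 1) = 0 /\
   'D_(z.2, w) f z = 0).
Proof.
move=> Uz; set K := tor f z + _; set F := 'D_(z.2, w) f z.
have E i : 'D_(z.2, w) (pdxi i half_square) z - pdx i half_square z =
    F * pdxi i f z + f z * (K * (if i == 0 then z.2 0 1 else - z.2 0 0)).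
  rewrite -(euler_lagrange1 oD sf hf w Uz i) pdx_half_square//.
  have -> : 'D_(z.2, w) (pdxi i half_square) z =
      'D_(z.2, w) (fun z => f z * pdxi i f z) z.
    by apply: near_eq_derive; apply: nU Uz _ => x Ux; exact: pdxi_half_square.
  have := derive_scale (z.2, w) (df Uz) (ddxi i Uz) => ->.
  by rewrite -/F -![_ *: _]/(_ * _); ring.
split=> [h|[K0 F0] i]; last first.
  by apply/eqP; rewrite -subr_eq0 E K0 F0 !mul0r mulr0 addr0.
have e0 := E 0; have e1 := E 1; rewrite h subrr /= in e0; rewrite h subrr /= in e1.
have eu := euler_f sf hf Uz; have fz := f0 Uz.
have F0 : F = 0.
  apply: (mulIf fz); rewrite mul0r -{1}eu.
  transitivity (z.2 0 0 * (F * pdxi 0 f z + f z * (K * z.2 0 1)) +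
    z.2 0 1 * (F * pdxi 1 f z + f z * (K * - z.2 0 0))); first by ring.
  by rewrite -e0 -e1 !mulr0 addr0.
split=> //; rewrite F0 !mul0r !add0r in e0 e1.
have n0 := fiber_norm_neq0 Uz.
apply: (mulIf (mulf_neq0 fz n0)); rewrite mul0r.
transitivity (z.2 0 1 * (f z * (K * z.2 0 1)) - z.2 0 0 * (f z * (K * - z.2 0 0))).
  by ring.
by rewrite -e0 -e1 !mulr0 subr0.
Qed.

(** The acceleration is sought as a combination of xi and (f_q, - f_p). The second vector does not
    change [f] and the first does not enter q w_0 - p w_1, so the two equations decouple: this
    coefficient solves F = 0, [spray_transverse] solves K = 0. *)
Definition spray_radial z : R :=
  - (z.2 0 0 * pdx 0 f z + z.2 0 1 * pdx 1 f z) * (f z)^-1.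

Definition spray_transverse z : R := - tor f z * (lam f z * f z)^-1.

(* The solution w of tor f + lam f * (q w_0 - p w_1) = 0 and D_(xi, w) f = 0. *)
Definition acceleration z : 'rV[R]_2 :=
  (spray_radial z * z.2 0 0 + spray_transverse z * pdxi 1 f z) *: delta_mx 0 0 +
  (spray_radial z * z.2 0 1 + - (spray_transverse z * pdxi 0 f z)) *: delta_mx 0 1.

Lemma acceleration_euler_lagrange z : U z ->
  forall i, 'D_(z.2, acceleration z) (pdxi i half_square) z = pdx i half_square z.
Proof.
move=> Uz; apply/(euler_lagrange2P _ Uz).
have a0 : acceleration z 0 0 =
    spray_radial z * z.2 0 0 + spray_transverse z * pdxi 1 f z.
  by rewrite !mxE/= mulr1 mulr0 addr0.
have a1 : acceleration z 0 1 =
    spray_radial z * z.2 0 1 - spray_transverse z * pdxi 0 f z.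
  by rewrite !mxE/= mulr1 mulr0 add0r.
have fz := f0 Uz; have lz := l0 Uz; have eu := euler_f sf hf Uz.
rewrite derive_coords2; last exact: df.
rewrite !a0 !a1 /spray_radial /spray_transverse; split.
  transitivity (tor f z - tor f z * (lam f z / (lam f z * f z)) *
    (z.2 0 0 * pdxi 0 f z + z.2 0 1 * pdxi 1 f z)); first by ring.
  by rewrite eu; field; rewrite fz lz.
set A := _ + _ * pdx 1 f z.
transitivity (A - A / f z * (z.2 0 0 * pdxi 0 f z + z.2 0 1 * pdxi 1 f z)).
  by ring.
by rewrite eu; field.
Qed.

Lemma smooth_spray : smooth_on U (fun z => (z.2, acceleration z)).
Proof.
have st : smooth_on U spray_transverse.
  apply: (smoothM oU); first by apply: (smoothN oU); exact: smooth_tor.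
  apply: (smoothV oU); last by apply: (smoothM oU) => //; exact: smooth_lam.
  by move=> z Uz; rewrite mulf_neq0 ?f0 ?l0.
have sc := smooth_fiber_coord D.
have sr : smooth_on U spray_radial.
  apply: (smoothM oU); last exact: smoothV.
  apply: (smoothN oU); apply: (smoothD oU); apply: (smoothM oU) => //;
    exact: smooth_pdx.
have sxi i : smooth_on U (pdxi i f) by exact: smooth_pdxi.
have sa : smooth_on U acceleration.
  apply: (smoothD oU); apply: (smoothZ oU) (smooth_cst _ _).
    by apply: (smoothD oU); exact: smoothM.
  apply: (smoothD oU); first exact: smoothM.
  by apply: (smoothN oU); exact: smoothM.
move=> k; apply: (Ck_pair oU) (sa k).
by apply: (@Ck_lin _ _ _ _ _ (@snd _ _ : {linear _ -> _})) => z; exact: cvg_snd.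
Qed.

Lemma local_geodesic z0 : U z0 -> exists2 d : R, 0 < d &
  exists y : R -> 'rV[R]_2 * 'rV[R]_2,
  [/\ y 0 = z0, smooth_on [set t : R | `|t| < d] y &
    forall t : R, `|t| < d -> U (y t) /\
      is_derive t 1 y ((y t).2, acceleration (y t))].
Proof.
move=> Uz0; set S := fun z => (z.2, acceleration z).
have /nbhs_ballP[r /= r0 hr] := open_nbhs_nbhs (conj oU Uz0).
have [||d1 d10 [y y0 hy]] := @ode_local R _ _ _ _ (pair_frame R 2) S z0 r r0.
- move=> z zr; apply: (smooth_diff smooth_spray); apply: hr.
  by rewrite -ball_normE /ball_/= distrC.
- by move=> i; exact: (smooth_continuous (smooth_derive _ smooth_spray) Uz0).
have yc : {for (0 : R), continuous y}.
  have [|h _] := hy 0; first by rewrite normr0.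
  exact/differentiable_continuous/derivable1_diffP.
have : \forall t \near (0 : R), U (y t).
  by apply: yc; apply: open_nbhs_nbhs; rewrite y0.
move=> /nbhs_ballP[d2 /= d20 hd2].
have m0 : 0 < Num.min d1 d2 by rewrite lt_min d10.
have yU (t : R) : `|t| < Num.min d1 d2 -> U (y t).
  rewrite lt_min => /andP[_ td2]; apply: hd2.
  by rewrite -ball_normE /ball_/= sub0r normrN.
have ht (t : R) : `|t| < Num.min d1 d2 -> is_derive t 1 y (S (y t)).
  by rewrite lt_min => /andP[td1 _]; exact: hy.
exists (Num.min d1 d2) => //; exists y; split=> // [|t td].
  apply: (ode_smooth (pair_frame R 2) _ smooth_spray) => //.
  rewrite (_ : [set _ | _] = ball (0 : R) (Num.min d1 d2)); first exact: ball_open.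
  by apply/seteqP; split=> s; rewrite -ball_normE /ball_/= sub0r normrN.
by split; [exact: yU|exact: ht].
Qed.

End Spray.
End Finsler.

(** * The ratio of the Hessians as a first integral, in one chart *)

Section Integral.
Variables (R : realType) (D : set 'rV[R]_2).
Hypothesis oD : open D.
Implicit Types (z : 'rV[R]_2 * 'rV[R]_2).

Local Notation U := (slit_over D).
Let oU : open U := slit_over_open oD.

Variables f g : 'rV[R]_2 * 'rV[R]_2 -> R.
Hypotheses (sf : smooth_on U f) (hf : homogeneous1 D f).
Hypotheses (sg : smooth_on U g) (hg : homogeneous1 D g).
Hypothesis lf0 : forall z, U z -> lam f z != 0.
Hypothesis lg0 : forall z, U z -> lam g z != 0.
Hypothesis fg : forall z, U z -> tor f z * lam g z = tor g z * lam f z.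

Definition hess_ratio z : R := hess_trace f z / hess_trace g z.

Lemma hess_trace_neq0 h z : U z -> lam h z != 0 -> hess_trace h z != 0.
Proof. by move=> Uz; apply: contraNneq; rewrite /lam => ->; rewrite mul0r. Qed.

Lemma hess_ratioE z : U z -> hess_ratio z = lam f z / lam g z.
Proof.
move=> Uz; have n0 := fiber_norm_neq0 Uz.
have h0 := hess_trace_neq0 Uz (lg0 Uz).
by rewrite /hess_ratio /lam; field; rewrite h0 n0.
Qed.

Lemma differentiable_hess_ratio z : U z -> differentiable hess_ratio z.
Proof.
move=> Uz; apply: differentiableM.
  by apply: (smooth_diff _ Uz); exact: smooth_hess_trace.
apply: differentiableV; last exact: hess_trace_neq0 Uz (lg0 Uz).
by apply: (smooth_diff _ Uz); exact: smooth_hess_trace.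
Qed.

Lemma hess_trace_homogeneous h z a : smooth_on U h -> homogeneous1 D h ->
  U z -> 0 < a -> a * hess_trace h (z.1, a *: z.2) = hess_trace h z.
Proof.
by move=> sh hh Uz a0; rewrite /hess_trace mulrDr !(dxi2_homogeneous oD sh hh).
Qed.

Lemma hess_ratio_homogeneous z a : U z -> 0 < a ->
  hess_ratio (z.1, a *: z.2) = hess_ratio z.
Proof.
move=> Uz a0; have an0 : a != 0 by rewrite gt_eqF.
have g0 := hess_trace_neq0 (slit_over_scale Uz a0) (lg0 (slit_over_scale Uz a0)).
rewrite /hess_ratio -(hess_trace_homogeneous sf hf Uz a0).
rewrite -(hess_trace_homogeneous sg hg Uz a0).
by field; rewrite an0 g0.
Qed.

(** Let X = p d_x0 + q d_x1 and I the ratio. Differentiating tor f = I tor g in xi and inserting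
    [dxi_tor] for both functions, the terms in X (lam g) cancel, leaving (q, - p) (X I) lam g =
    (d_xi I) tor g. The hypothesis replaces tor g by - lam g (q w_0 - p w_1), and Euler's identity
    for the 0-homogeneous I does the rest. *)
Lemma derive_hess_ratio z (w : 'rV[R]_2) : U z ->
  tor g z + lam g z * (z.2 0 1 * w 0 0 - z.2 0 0 * w 0 1) = 0 ->
  'D_(z.2, w) hess_ratio z = 0.
Proof.
move=> Uz K; have dI := differentiable_hess_ratio Uz.
have euI : z.2 0 0 * pdxi 0 hess_ratio z + z.2 0 1 * pdxi 1 hess_ratio z = 0.
  rewrite -(derive_fiber2 _ dI); apply: (euler0 Uz dI) => a; exact: hess_ratio_homogeneous.
have nU (P : _ -> Prop) : (forall z, U z -> P z) -> \forall w \near z, P w.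
  by move=> h; apply: filterS (open_nbhs_nbhs (conj oU Uz)).
have dl : differentiable (lam g) z by apply: (smooth_diff _ Uz); exact: smooth_lam.
have dt : differentiable (tor g) z by apply: (smooth_diff _ Uz); exact: smooth_tor.
have lE x : U x -> lam f x = hess_ratio x * lam g x.
  by move=> Ux; rewrite hess_ratioE// divfK// lg0.
have tE x : U x -> tor f x = hess_ratio x * tor g x.
  move=> Ux; apply: (mulIf (lg0 Ux)); rewrite fg// hess_ratioE//.
  by field; rewrite lg0.
have dlE i : pdx i (lam f) z = pdx i hess_ratio z * lam g z + hess_ratio z * pdx i (lam g) z.
  by rewrite -(pdxM i dI dl); apply/near_eq_pdx/nU.
have dtE i : pdxi i (tor f) z = pdxi i hess_ratio z * tor g z + hess_ratio z * pdxi i (tor g) z.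
  by rewrite -(pdxiM i dI dt); apply/near_eq_pdxi/nU.
have T0 := dtE 0; have T1 := dtE 1.
rewrite !(dxi_tor oD sf hf Uz) !(dxi_tor oD sg hg Uz) /= !dlE in T0 T1.
rewrite (derive_coords2 _ _ dI).
have n0 := fiber_norm_neq0 Uz; have lg := lg0 Uz.
move: (pdx 0 hess_ratio z) (pdx 1 hess_ratio z) (pdxi 0 hess_ratio z)
  (pdxi 1 hess_ratio z) (hess_ratio z) (pdx 0 (lam g) z) (pdx 1 (lam g) z)
  (lam g z) (tor g z) lg K T0 T1 euI => X0 X1 Y0 Y1 J l0 l1 l t l_neq0 K T0 T1 e.
move: (z.2 0 0) (z.2 0 1) (w 0 0) (w 0 1) n0 K T0 T1 e => p q w0 w1 n0 K T0 T1 e.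
have {K}tE : t = - (l * (q * w0 - p * w1)) by apply/eqP; rewrite -addr_eq0; apply/eqP.
have {}T0 : q * (p * X0 + q * X1) * l = Y0 * t.
  apply/eqP; rewrite -subr_eq0; apply/eqP.
  by move/eqP: T0; rewrite -subr_eq0 => /eqP T0; rewrite -[RHS]T0; ring.
have {}T1 : - p * (p * X0 + q * X1) * l = Y1 * t.
  apply/eqP; rewrite -subr_eq0; apply/eqP.
  by move/eqP: T1; rewrite -subr_eq0 => /eqP T1; rewrite -[RHS]T1; ring.
(* With Y = d_xi I, the identity behind is (p^2 + q^2) (w_0 Y_0 + w_1 Y_1) = (p w_0 + q w_1) (p Y_0
   + q Y_1) + (q w_0 - p w_1) (q Y_0 - p Y_1): the last term cancels against X I, and the other
   vanishes by Euler. *)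
apply: (mulIf (mulf_neq0 l_neq0 n0)); rewrite mul0r.
transitivity (q * (q * (p * X0 + q * X1) * l) - p * (- p * (p * X0 + q * X1) * l)
   + l * (p ^+ 2 + q ^+ 2) * (w0 * Y0 + w1 * Y1)); first by ring.
rewrite T0 T1 tE.
transitivity (l * (p * w0 + q * w1) * (p * Y0 + q * Y1)); first by ring.
by rewrite e mulr0.
Qed.

End Integral.

(** * Change of coordinates *)

Section Transitions.
Variables (R : realType) (n : nat) (M : manifold R n).
Implicit Types (phi psi : chart R n M) (p : M).

Definition overlap phi psi : set 'rV[R]_n :=
  cmap phi @` (cdom phi `&` cdom psi).

Lemma overlap_open phi psi : open (overlap phi psi).
Proof.
rewrite openE => _ [p [php psp] <-].
apply: filterS (cdom_nbhs php psp) => x [[q hq <-]].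
by rewrite cmapK// => psq; exists q.
Qed.

Lemma smooth_transition phi psi : atlas phi -> atlas psi ->
  smooth_on (overlap phi psi) (transition phi psi).
Proof. by move=> hphi hpsi; have [] := atlas_compatible hphi hpsi. Qed.

Lemma overlap_cimg phi psi : overlap phi psi `<=` cimg phi.
Proof. by move=> _ [p [php _] <-]; exists p. Qed.

Lemma transition_overlap phi psi x : overlap phi psi x ->
  overlap psi phi (transition phi psi x).
Proof. by move=> [p [php psp] <-]; rewrite /transition /= cmapK//; exists p. Qed.

Lemma local_transition (F : tangent M -> R) phi psi x xi :
  atlas phi -> atlas psi -> overlap phi psi x ->
  local F phi (x, xi) = local F psi (transition phi psi x, 'd (transition phi psi) x xi).
Proof.
move=> hphi hpsi [p [php psp] <-].
have h : chart_at p phi by [].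
have h' : chart_at p psi by [].
have e1 : tcoords phi (tangent_of h xi) = (cmap phi p, xi).
  by congr (_, _); exact: tangent_ofE.
have e2 : tcoords psi (tangent_of h xi) =
    (transition phi psi (cmap phi p), 'd (transition phi psi) (cmap phi p) xi).
  rewrite /tcoords (@tcomp_law _ _ _ (tangent_of h xi) phi psi h h').
  rewrite tangent_ofE /transition /= cmapK//.
have := @localE _ _ _ F phi (tangent_of h xi) h.
by rewrite -(@localE _ _ _ F psi (tangent_of h xi) h') e1 e2.
Qed.

Lemma transition_diffK phi psi x v : atlas phi -> atlas psi -> overlap phi psi x ->
  'd (transition psi phi) (transition phi psi x) ('d (transition phi psi) x v) = v.
Proof.
move=> hphi hpsi [p [php psp] <-].
have h : chart_at p phi by [].
have h' : chart_at p psi by [].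
have -> : transition phi psi (cmap phi p) = cmap psi p.
  by rewrite /transition /= cmapK.
exact: etrans (esym (transition_diff_comp v h h' h)) (transition_diff_id v h).
Qed.

Lemma transition_diffKV phi psi x v : atlas phi -> atlas psi -> overlap phi psi x ->
  'd (transition phi psi) x ('d (transition psi phi) (transition phi psi x) v) = v.
Proof.
move=> hphi hpsi xo; have := transition_diffK v hpsi hphi (transition_overlap xo).
have -> // : transition psi phi (transition phi psi x) = x.
by move: xo => [p [php psp] <-]; rewrite /transition /= !cmapK.
Qed.

Lemma slit_overlap_sub phi psi : slit_over (overlap phi psi) `<=` slit_over (cimg phi).
Proof. by move=> z [/overlap_cimg]. Qed.

Lemma slit_transition phi psi x xi : atlas phi -> atlas psi ->
  slit_over (overlap phi psi) (x, xi) ->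
  slit_over (cimg psi) (transition phi psi x, 'd (transition phi psi) x xi).
Proof.
move=> hphi hpsi [/= xo xi0]; split=> /=.
  exact/overlap_cimg/transition_overlap.
apply: contraNneq xi0 => e; apply/eqP.
have h := transition_diffK xi hphi hpsi xo.
pose A : {linear _ -> _} := 'd (transition psi phi) (transition phi psi x).
exact: etrans (esym h) (etrans (congr1 A e) (linear0 A)).
Qed.

End Transitions.

Section LinearFiber.
Variables (R : realType) (m n : nat).

(** Chain rule along the line xi + s v over a fixed base point. The relation between [h] and [k] is
    known off the zero section only, which suffices because xi + s v stays nonzero for small s. *)
Lemma derive_fiber_linear (h : 'rV[R]_m * 'rV[R]_m -> R)
    (k : 'rV[R]_n * 'rV[R]_n -> R) (B : {linear 'rV[R]_m -> 'rV[R]_n})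
    x x' xi v :
  differentiable h (x, xi) -> differentiable k (x', B xi) ->
  (forall eta, eta != 0 -> h (x, eta) = k (x', B eta)) -> xi != 0 ->
  'D_(0, v) h (x, xi) = 'D_(0, B v) k (x', B xi).
Proof.
move=> dh dk hk xi0.
have dh' : differentiable h ((x, xi) + (0 : R) *: (0, v)) by rewrite scale0r addr0.
have dk' : differentiable k ((x', B xi) + (0 : R) *: (0, B v)) by rewrite scale0r addr0.
have [_ ] := is_derive_comp (is_derive_line (x, xi) (0, v) (0 : R)) dh'.
have [_ ] := is_derive_comp (is_derive_line (x', B xi) (0, B v) (0 : R)) dk'.
rewrite !scale0r !addr0 => <- <-.
apply: near_eq_derive.
have : \forall s \near (0 : R), xi + s *: v != 0.
  have c : {for (0 : R), continuous (fun s : R => xi + s *: v)}.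
    have [h1 _] := is_derive_line xi v (0 : R).
    exact/differentiable_continuous/derivable1_diffP.
  apply: (c [set z | z != 0]); rewrite scale0r addr0; apply: open_nbhs_nbhs; split=> //.
  rewrite (_ : [set z | z != 0] = (fun z : 'rV[R]_m => `|z|) @^-1` [set x : R | 0 < x]).
    apply: open_comp => //; first by move=> z _; exact: norm_continuous.
  by apply/seteqP; split=> z; rewrite /= normr_gt0.
apply: filterS => s s0 /=.
have -> : (x, xi) + s *: (0, v) = (x, xi + s *: v).
  by apply: injective_projections; rewrite /= ?scaler0 ?addr0.
have -> : (x', B xi) + s *: (0, B v) = (x', B (xi + s *: v)).
  by apply: injective_projections; rewrite /= ?scaler0 ?addr0 ?linearD ?linearZ.
exact: hk.
Qed.

End LinearFiber.

Section FinslerChart.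
Variables (R : realType) (n : nat) (M : manifold R n) (F : tangent M -> R).
Hypothesis hF : finsler_metric F.

Lemma finsler_smooth phi : atlas phi -> smooth_on (slit_over (cimg phi)) (local F phi).
Proof. by case: hF => _ _ h _; exact: h. Qed.

Lemma local_ge0 phi z : 0 <= local F phi z.
Proof. by case: hF => h _ _ _; rewrite /local; case: pselect. Qed.

Lemma slit_tcoords (v : tangent M) phi : nonzero v -> chart_at (tbase v) phi ->
  slit_over (cimg phi) (tcoords phi v).
Proof.
move=> v0 h; split; last exact: v0.
by exists (tbase v) => //; case: h.
Qed.

End FinslerChart.

Section VectorCalculus.
Variable R : realType.

Lemma is_derive_pair (W W' : normedModType R) (f : R -> W) (g : R -> W') (t : R) a b :
  is_derive t 1 f a -> is_derive t 1 g b ->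
  is_derive t 1 (fun s => (f s, g s)) (a, b).
Proof.
move=> [/derivable1_diffP df dfE] [/derivable1_diffP dg dgE].
have d := differentiable_pair df dg.
split; first exact: diff_derivable.
by rewrite deriveE// diff_pair//= -!deriveE// dfE dgE.
Qed.

Lemma derive_coord (V : normedModType R) n (f : V -> 'rV[R]_n) x v a :
  differentiable f x -> 'D_v (fun x => f x 0 a) x = ('D_v f x) 0 a.
Proof.
move=> df.
have := derive_comp v df (linear_differentiable (f x) (@row_coord_continuous R n a)).
by rewrite (derive_linfun _ _ (@row_coord_continuous R n a)).
Qed.

Lemma smooth_coord (V : normedModType R) n (A : set V) (f : V -> 'rV[R]_n) a :
  open A -> smooth_on A f -> smooth_on A (fun x => f x 0 a).
Proof.
move=> oA sf k.
exact: (Ck_linl (l := row_coord a : {linear _ -> _}) oA (@row_coord_continuous R n a) (sf k)).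
Qed.

Lemma smooth_schwarz_row (V : normedModType R) n (A : set V) (f : V -> 'rV[R]_n) z u v :
  open A -> smooth_on A f -> A z -> 'D_v ('D_u f) z = 'D_u ('D_v f) z.
Proof.
move=> oA sf Az; apply/rowP => a.
have key w w' : ('D_w ('D_w' f) z) 0 a = 'D_w ('D_w' (fun x => f x 0 a)) z.
  rewrite -derive_coord; last exact: smooth_diff (smooth_derive w' sf) Az.
  apply: near_eq_derive; apply: filterS (open_nbhs_nbhs (conj oA Az)) => x Ax.
  by rewrite derive_coord//; exact: smooth_diff sf Ax.
exact: etrans (key v u) (etrans (smooth_schwarz _ _ oA (smooth_coord _ oA sf) Az) (esym (key u v))).
Qed.

Lemma open_preimage (M : topologicalType) (J : set R) (B : set M) (c : R -> M) :
  open J -> open B -> (forall t, J t -> {for t, continuous c}) ->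
  open (J `&` c @^-1` B).
Proof.
move=> oJ oB cc; rewrite openE => t [Jt Bt]; apply: filterI.
  by apply: open_nbhs_nbhs.
by apply: (cc t Jt); apply: open_nbhs_nbhs.
Qed.

End VectorCalculus.

(** * Covariance of the Euler-Lagrange equation *)

Section EulerLagrangeTransition.
Variables (R : realType) (n : nat) (A : set 'rV[R]_n) (T : 'rV[R]_n -> 'rV[R]_n).
Hypotheses (oA : open A) (sT : smooth_on A T).
Implicit Types (x xi v : 'rV[R]_n).

(** [ttransition], for a general map [T] in place of a transition. *)
Definition tangent_map (z : 'rV[R]_n * 'rV[R]_n) : 'rV[R]_n * 'rV[R]_n :=
  (T z.1, 'd T (z.1) (z.2)).

Let dT x : A x -> differentiable T x := smooth_diff sT.

Lemma is_derive_tangent_map x xi v : A x ->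
  is_derive (0 : R) 1 (fun s : R => tangent_map (x + s *: v, xi))
    ('D_v T x, 'D_v ('D_xi T) x).
Proof.
move=> Ax; have l := is_derive_line x v (0 : R).
have x0 : x + (0 : R) *: v = x by rewrite scale0r addr0.
have dTx : differentiable T (x + (0 : R) *: v) by rewrite x0; exact: dT.
have dDx : differentiable ('D_xi T) (x + (0 : R) *: v).
  by rewrite x0; exact: smooth_diff (smooth_derive xi sT) Ax.
have := is_derive_pair (is_derive_comp l dTx) (is_derive_comp l dDx).
rewrite x0; apply: near_eq_is_derive.
have c : {for (0 : R), continuous (fun s : R => x + s *: v)}.
  by have [h1 _] := l; exact/differentiable_continuous/derivable1_diffP.
have : \forall s \near (0 : R), A (x + s *: v).
  by apply: (c A); rewrite x0; exact: (open_nbhs_nbhs (conj oA Ax)).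
apply: filterS => s As; apply: injective_projections; first by [].
exact: deriveE (dT As).
Qed.

Variables (L G : 'rV[R]_n * 'rV[R]_n -> R).
Hypothesis LG : forall z, slit_over A z -> L z = G (tangent_map z).
Hypothesis dL : forall z, slit_over A z -> differentiable L z.
Hypothesis dG : forall z, slit_over A z -> differentiable G (tangent_map z).

Lemma derive_fiber_transition x xi v : A x -> xi != 0 ->
  'D_(0, v) L (x, xi) = 'D_(0, 'D_v T x) G (tangent_map (x, xi)).
Proof.
move=> Ax xi0; rewrite (deriveE v (dT Ax)).
apply: derive_fiber_linear => //.
- by apply: dL.
- by apply: (@dG (x, xi)).
- by move=> eta eta0; rewrite (@LG (x, eta)).
Qed.

(** Moving the base point with fixed components xi also moves the new components ['d T x xi], whence
    the second derivative of [T] in the fiber direction. *)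
Lemma derive_base_transition x xi v : A x -> xi != 0 ->
  'D_(v, 0) L (x, xi) =
  'D_('D_v T x, 'D_v ('D_xi T) x) G (tangent_map (x, xi)).
Proof.
move=> Ax xi0.
have Uz : slit_over A (x, xi) by [].
have x0 : x + (0 : R) *: v = x by rewrite scale0r addr0.
have l : is_derive (0 : R) 1 (fun s : R => (x + s *: v, xi)) (v, 0).
  exact: is_derive_pair (is_derive_line x v (0 : R)) (is_derive_cst xi (0 : R) 1).
have dL0 : differentiable L (x + (0 : R) *: v, xi) by rewrite x0; exact: dL.
have dG0 : differentiable G (tangent_map (x + (0 : R) *: v, xi)).
  by rewrite x0; exact: dG.
have [_ e1] := is_derive_comp l dL0.
have [_ e2] := is_derive_comp (is_derive_tangent_map xi v Ax) dG0.
rewrite x0 in e1 e2; rewrite -e1 -e2; apply: near_eq_derive.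
have c : {for (0 : R), continuous (fun s : R => x + s *: v)}.
  have [h1 _] := is_derive_line x v (0 : R).
  exact/differentiable_continuous/derivable1_diffP.
have : \forall s \near (0 : R), A (x + s *: v).
  by apply: (c A); rewrite x0; exact: (open_nbhs_nbhs (conj oA Ax)).
by apply: filterS => s As; have h := @LG (x + s *: v, xi) (conj As xi0); exact: h.
Qed.

Hypothesis dT_surj : forall x, A x -> forall v, exists w, 'd T x w = v.
Hypothesis dpG : forall i z, slit_over A z -> differentiable (pdxi i G) (tangent_map z).

(** With rho the time derivative of the momenta of [G], differentiating L_(xi j) = sum_a (D_j T)_a
    G_(xi a) in time and comparing with L_(x j) yields second derivatives of [T] on both sides; they
    agree by Schwarz. What is left says that rho - G_x annihilates the image of ['d T], which is
    everything. *)
Lemma euler_lagrange_transition (y : R -> 'rV[R]_n * 'rV[R]_n) (t : R) w :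
  (\forall s \near t, slit_over A (y s)) ->
  is_derive t 1 y ((y t).2, w) ->
  differentiable (fun s => tangent_map (y s)) t ->
  (forall j, is_derive t 1 (fun s => pdxi j L (y s)) (pdx j L (y t))) ->
  forall a, is_derive t 1 (fun s => pdxi a G (tangent_map (y s)))
    (pdx a G (tangent_map (y t))).
Proof.
move=> yA dy dty hL; have Ut : slit_over A (y t) by exact: nbhs_singleton yA.
have [At xi0] := Ut.
pose rho a := 'D_1 (fun s => pdxi a G (tangent_map (y s))) t.
have drho a : is_derive t 1 (fun s => pdxi a G (tangent_map (y s))) (rho a).
  split=> //; apply/derivable1_diffP.
  exact: (differentiable_comp dty (dpG a Ut)).
suff r0 a : rho a = pdx a G (tangent_map (y t)) by move=> a; rewrite -r0.
move: a; set x := (y t).1 in At *; set xi := (y t).2 in xi0 dy *.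
have ytE : y t = (x, xi) by rewrite /x /xi; case: (y t).
have dx : is_derive t 1 (fun s => (y s).1) xi.
  have h := is_derive_comp dy (@linear_differentiable _ _ _ (@fst _ _ : {linear _ -> _}) (y t) (fun z => cvg_fst)).
  by rewrite (@derive_linfun _ _ _ (@fst _ _ : {linear _ -> _}) _ _ (fun z => cvg_fst)) in h; exact: h.
have eqj j : \sum_a ('D_(delta_mx 0 j) T x) 0 a * (rho a - pdx a G (tangent_map (y t))) = 0.
  have near_fiber : \forall s \near t, pdxi j L (y s) =
      \sum_a ('D_(delta_mx 0 j) T (y s).1) 0 a * pdxi a G (tangent_map (y s)).
    apply: filterS yA => s Us; rewrite -derive_fiber_delta.
    have := derive_fiber_transition (delta_mx 0 j) Us.1 Us.2.
    rewrite -surjective_pairing => ->; rewrite derive_partials; last exact: dG.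
    have z0 : \sum_i (0 : 'rV[R]_n) 0 i * pdx i G (tangent_map (y s)) = 0.
      by apply: big1 => i _; rewrite (_ : (0 : 'rV[R]_n) 0 i = 0) ?mxE//; exact: mul0r.
    exact: etrans (congr2 +%R z0 erefl) (add0r _).
  have dDj : differentiable ('D_(delta_mx 0 j) T) x.
    exact: smooth_diff (smooth_derive _ sT) At.
  have dsum : is_derive t 1
      (fun s => \sum_a ('D_(delta_mx 0 j) T (y s).1) 0 a * pdxi a G (tangent_map (y s)))
      (\sum_a (('D_(delta_mx 0 j) T x) 0 a * rho a +
        pdxi a G (tangent_map (y t)) * ('D_xi ('D_(delta_mx 0 j) T) x) 0 a)).
    apply: is_derive_fsum => a.
    have dDa : is_derive t 1 (fun s => ('D_(delta_mx 0 j) T (y s).1) 0 a)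
        (('D_xi ('D_(delta_mx 0 j) T) x) 0 a).
      have h := is_derive_comp dx dDj.
      have := is_derive_comp h (linear_differentiable ('D_(delta_mx 0 j) T x) (@row_coord_continuous R n a)).
      by rewrite (derive_linfun _ _ (@row_coord_continuous R n a)).
    exact: (is_deriveM dDa (drho a)).
  have [_ e1] := near_eq_is_derive near_fiber (hL j).
  have [_ e2] := dsum; rewrite e1 in e2.
  have := derive_base_transition (delta_mx 0 j) At xi0.
  rewrite derive_base_delta -ytE e2 derive_partials; last exact: dG.
  rewrite -big_split/= (smooth_schwarz_row _ _ oA sT At) => /eqP.
  rewrite -subr_eq0 -sumrB => /eqP e3; rewrite -[RHS]e3.
  by apply: eq_bigr => a _; ring.
have eqv v : \sum_a ('d T x v) 0 a * (rho a - pdx a G (tangent_map (y t))) = 0.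
  have -> : 'd T x v = \sum_j v 0 j *: 'D_(delta_mx 0 j) T x.
    by rewrite -deriveE; [rewrite [in LHS](row_sum_delta v) derive_sumdir//; exact: dT|exact: dT].
  rewrite (_ : \sum_a _ = \sum_j v 0 j * \sum_a ('D_(delta_mx 0 j) T x) 0 a *
      (rho a - pdx a G (tangent_map (y t)))).
    by rewrite big1// => j _; rewrite eqj mulr0.
  under eq_bigr do rewrite summxE mulr_suml.
  rewrite exchange_big; apply: eq_bigr => j _; rewrite mulr_sumr.
  by apply: eq_bigr => a _; rewrite mxE mulrA.
move=> b; have [w' hw'] := dT_surj At (delta_mx 0 b).
have := eqv w'; rewrite hw' (bigD1 b)//= big1 ?addr0.
  by rewrite mxE !eqxx mul1r => /eqP; rewrite subr_eq0 => /eqP.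
by move=> a ab; rewrite mxE eqxx (negbTE ab) mul0r.
Qed.

End EulerLagrangeTransition.

(** * Geodesics of a Finsler metric *)

Section CurvesInCharts.
Variables (R : realType) (n : nat) (M : manifold R n).
Implicit Types (phi psi : chart R n M) (c : R -> M) (J : set R) (t : R).

Lemma open_cimg phi : open (cimg phi).
Proof. exact: cimg_open. Qed.

Definition chart_accel phi c t : 'rV[R]_n := 'D_1 ('D_1 (cmap phi \o c)) t.

Lemma lift_coordsE phi c : lift_coords phi c =
  (fun t => ((cmap phi \o c) t, 'D_1 (cmap phi \o c) t)).
Proof. by apply/funext => t; rewrite /lift_coords derive1E. Qed.

Lemma is_derive_lift phi c J t : open J -> smooth_on J (cmap phi \o c) -> J t ->
  is_derive t 1 (lift_coords phi c) ((lift_coords phi c t).2, chart_accel phi c t).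
Proof.
move=> oJ sc Jt; rewrite lift_coordsE; apply: is_derive_pair.
  by split=> //; exact/derivable1_diffP/(smooth_diff sc Jt).
have d2 := smooth_diff (smooth_derive (1 : R) sc) Jt.
by split; [exact/derivable1_diffP|].
Qed.

Lemma geodesic_chart_open F J c phi : geodesic F J c ->
  open (J `&` c @^-1` cdom phi).
Proof.
case=> [[oJ _] [cc _] _ _]; apply: open_preimage => //; exact: cdom_open.
Qed.

Lemma geodesic_is_derive_lift F J c phi t : geodesic F J c -> J t ->
  chart_at (c t) phi ->
  is_derive t 1 (lift_coords phi c) ((lift_coords phi c t).2, chart_accel phi c t).
Proof.
move=> gc Jt [aphi ct]; have [_ [_ sc] _ _] := gc.
exact: (is_derive_lift (geodesic_chart_open (phi := phi) gc) (sc phi aphi) (conj Jt ct)).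
Qed.

Lemma geodesic_slit F J c phi t : geodesic F J c -> J t -> chart_at (c t) phi ->
  slit_over (cimg phi) (lift_coords phi c t).
Proof.
move=> [_ _ rc _] Jt h; split; last exact: rc.
by exists (c t) => //; case: h.
Qed.

End CurvesInCharts.

(** * Geodesics on a surface: scalar equation and existence *)

Section SurfaceFinsler.
Variables (R : realType) (S : manifold R 2) (F : tangent S -> R).
Hypothesis hF : finsler_metric F.
Implicit Types (phi psi : chart R 2 S).

Lemma finsler_homogeneous1 phi : atlas phi -> homogeneous1 (cimg phi) (local F phi).
Proof.
by move=> aphi [x xi] a [/= Dx _] a0; case: hF => _ h _ _; exact: h.
Qed.

Lemma finsler_positive phi z : atlas phi -> slit_over (cimg phi) z ->
  positive_definite (2^-1 *: fiber_hessian (fun w => local F phi w ^+ 2) z).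
Proof. by move=> aphi Uz; case: hF => _ _ _ h; exact: h. Qed.

Lemma local_gt0 phi z : atlas phi -> slit_over (cimg phi) z -> 0 < local F phi z.
Proof.
move=> aphi; apply: (finsler_gt0 (@open_cimg R 2 S phi)) => //.
- exact: finsler_smooth.
- exact: finsler_homogeneous1.
- by move=> w; exact: local_ge0.
- by move=> w Uw; exact: finsler_positive.
Qed.

Lemma lam_local_gt0 phi z : atlas phi -> slit_over (cimg phi) z ->
  0 < lam (local F phi) z.
Proof.
move=> aphi; apply: (lam_gt0 (@open_cimg R 2 S phi)) => //.
- exact: finsler_smooth.
- exact: finsler_homogeneous1.
- by move=> w; exact: local_ge0.
- by move=> w Uw; exact: finsler_positive.
Qed.

Lemma geodesic_scalar J c phi t : geodesic F J c -> J t -> chart_at (c t) phi ->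
  let z := lift_coords phi c t in let w := chart_accel phi c t in
  tor (local F phi) z + lam (local F phi) z * (z.2 0 1 * w 0 0 - z.2 0 0 * w 0 1) = 0.
Proof.
move=> gc Jt h z w; have aphi := h.1.
have Uz : slit_over (cimg phi) z := geodesic_slit gc Jt h.
have f0 x : slit_over (cimg phi) x -> local F phi x != 0.
  by move=> Ux; rewrite gt_eqF// local_gt0.
have oD := @open_cimg R 2 S phi.
have [+ _] := euler_lagrange2P oD (finsler_smooth hF aphi) (finsler_homogeneous1 aphi) f0 w Uz.
suff E i : 'D_(z.2, w) (pdxi i (half_square (local F phi))) z =
    pdx i (half_square (local F phi)) z by move=> /(_ E)[].
have [_ _ _ el] := gc; have [_ e1] := el t Jt phi h i.
rewrite -pdxE -pdxiE in e1.
have dl := geodesic_is_derive_lift gc Jt h.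
have d : differentiable (pdxi i (half_square (local F phi))) (lift_coords phi c t).
  apply: (smooth_diff _ Uz); apply: smooth_pdxi.
  exact: (smooth_half_square oD (finsler_smooth hF aphi)).
have [_ e2] := is_derive_comp dl d.
exact: etrans (esym e2) e1.
Qed.

(** The integral curve of the spray in [phi] is projected to the surface by [cinv phi]. Regularity,
    smoothness and the Euler-Lagrange equation are required in every chart [psi] met by the curve,
    so each is transported along the transition from [phi] to [psi]. *)
Lemma geodesic_exists phi z0 : atlas phi -> slit_over (cimg phi) z0 ->
  exists J c, [/\ geodesic F J c, J 0, chart_at (c 0) phi & lift_coords phi c 0 = z0].
Proof.
move=> aphi Uz0; have oD := @open_cimg R 2 S phi.
have sf := finsler_smooth hF aphi; have hf := finsler_homogeneous1 aphi.
have f0 x : slit_over (cimg phi) x -> local F phi x != 0.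
  by move=> Ux; rewrite gt_eqF// local_gt0.
have l0 x : slit_over (cimg phi) x -> lam (local F phi) x != 0.
  by move=> Ux; rewrite gt_eqF// lam_local_gt0.
have [d d0 [y [y0 sy hy]]] := local_geodesic oD sf f0 l0 Uz0.
pose J := [set t : R | `|t| < d]; pose c t := cinv phi (y t).1.
have JE : J = ball (0 : R) d.
  by apply/seteqP; split=> s; rewrite /J -ball_normE /ball_/= sub0r normrN.
have oJ : open J by rewrite JE; exact: ball_open.
have yU t : J t -> slit_over (cimg phi) (y t) by move=> Jt; have [] := hy t Jt.
have cphi t : J t -> cdom phi (c t).
  by move=> /yU[[p hp e] _]; rewrite /c -e cmapK.
have cmapc t : J t -> cmap phi (c t) = (y t).1.
  by move=> /yU[[p hp e] _]; rewrite /c -e cmapK.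
have hc t : J t -> chart_at (c t) phi by move=> Jt; split=> //; exact: cphi.
have sx : smooth_on J (fun t => (y t).1).
  move=> k; apply: (Ck_linl (l := @fst _ _ : {linear _ -> _}) oJ) (sy k).
  by move=> z; exact: cvg_fst.
have cc t : J t -> {for t, continuous c}.
  move=> Jt; apply: continuous_comp; first exact: smooth_continuous sx Jt.
  by apply: cinv_continuous; exact: (yU t Jt).1.
have dx t : J t -> is_derive t 1 (fun t => (y t).1) (y t).2.
  move=> Jt; have [_ dy] := hy t Jt.
  have h := is_derive_comp dy (@linear_differentiable _ _ _ (@fst _ _ : {linear _ -> _}) (y t) (fun z => cvg_fst)).
  by rewrite (@derive_linfun _ _ _ (@fst _ _ : {linear _ -> _}) _ _ (fun z => cvg_fst)) in h; exact: h.
have ov psi t : J t -> cdom psi (c t) -> overlap phi psi (y t).1.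
  by move=> Jt cpsi; exists (c t); [split=> //; exact: cphi|exact: cmapc].
have oJp psi : open (J `&` c @^-1` cdom psi).
  by apply: open_preimage => //; exact: cdom_open.
have spsi psi : atlas psi -> smooth_on (J `&` c @^-1` cdom psi) (cmap psi \o c).
  move=> apsi k.
  apply: (Ck_comp (row_frame R 2) (oJp psi) _ _ (smooth_transition aphi apsi k)).
    by move=> t [Jt cpsi]; exact: ov.
  by apply: Ck_sub (sx k) => t [].
have liftE psi t : atlas psi -> J t -> cdom psi (c t) ->
    lift_coords psi c t = tangent_map (transition phi psi) (y t).
  move=> apsi Jt cpsi; rewrite lift_coordsE; apply: injective_projections; first by [].
  have dT := smooth_diff (smooth_transition aphi apsi) (ov _ _ Jt cpsi).
  have [_ e] := is_derive_comp (dx t Jt) dT.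
  by rewrite /tangent_map /= -(deriveE _ dT); exact: e.
have J0 : J 0 by rewrite /J /= normr0.
exists J, c; split; [split|exact: J0|exact: hc|].
- split=> // x1 x2; rewrite /J /= !ltr_norml => /andP[h1 h2] /andP[h3 h4] x3 /andP[h5 h6].
  by rewrite ltr_norml; apply/andP; split; lra.
- by split.
- move=> t Jt psi [apsi cpsi].
  have Uo : slit_over (overlap phi psi) ((y t).1, (y t).2).
    by split; [exact: ov|exact: (yU t Jt).2].
  have := (slit_transition aphi apsi Uo).2.
  by have := congr1 snd (liftE psi t apsi Jt cpsi) => /= <-.
- move=> t Jt psi [apsi cpsi] i.
  have UA : \forall s \near t, J s /\ cdom psi (c s).
    by apply: (open_nbhs_nbhs (conj (oJp psi) _)).
  have Lt s : J s -> cdom psi (c s) -> slit_over (overlap phi psi) (y s).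
    by move=> Js cs; split; [exact: ov|exact: (yU s Js).2].
  have slitT z : slit_over (overlap phi psi) z ->
      slit_over (cimg psi) (tangent_map (transition phi psi) z).
    by case: z => x xi; exact: slit_transition.
  have sL := smooth_half_square oD sf.
  have sG := smooth_half_square (@open_cimg R 2 S psi) (finsler_smooth hF apsi).
  have [_ dy] := hy t Jt.
  have near_lift : \forall s \near t,
      lift_coords psi c s = tangent_map (transition phi psi) (y s).
    by apply: filterS UA => s [Js cs]; exact: liftE.
  have key := @euler_lagrange_transition R 2 _ _ (@overlap_open R 2 S phi psi)
    (smooth_transition aphi apsi) (half_square (local F phi))
    (half_square (local F psi)) _ _ _ _ _ y t _ _ dy.
  have {}key : is_derive t 1
      (fun s => pdxi i (half_square (local F psi)) (tangent_map (transition phi psi) (y s)))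
      (pdx i (half_square (local F psi)) (tangent_map (transition phi psi) (y t))).
    apply: key.
    + move=> [x xi] [/= xo _]; rewrite /half_square.
      by rewrite (local_transition F xi aphi apsi xo).
    + by move=> z /slit_overlap_sub Uz; exact: smooth_diff sL Uz.
    + by move=> z /slitT Uz; exact: smooth_diff sG Uz.
    + move=> x xo v; eexists; exact: (transition_diffKV v aphi apsi xo).
    + by move=> j z /slitT Uz; exact: smooth_diff (smooth_pdxi j sG) Uz.
    + by apply: filterS UA => s [Js cs]; exact: Lt.
    (* Differentiability of the transported curve is read off the lift of [c] in [psi], with which
       it agrees near [t]. *)
    + have [/derivable1_diffP dl _] := is_derive_lift (oJp psi) (spsi psi apsi) (conj Jt cpsi).
      by have [] := near_eq_diff near_lift dl.
    + move=> j; have dj := smooth_diff (smooth_pdxi j sL) (yU t Jt).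
      have := is_derive_comp dy dj.
      by rewrite (acceleration_euler_lagrange oD sf hf f0 l0 (yU t Jt) j).
  rewrite (nbhs_singleton near_lift) -pdxE -pdxiE.
  apply: near_eq_is_derive key.
  by apply: filterS near_lift => s ->.
- rewrite (liftE phi 0 aphi J0 (cphi 0 J0)) y0.
  have [p hp e] := Uz0.1; have hpp : chart_at p phi by [].
  apply: injective_projections; rewrite /tangent_map /= -e.
    by rewrite /transition /= cmapK.
  exact: transition_diff_id.
Qed.

End SurfaceFinsler.

(** * The ratio of the fiber Hessians *)

Section HomogeneousFactors.
Variables (R : realType) (D : set 'rV[R]_2).
Hypothesis oD : open D.
Variable f : 'rV[R]_2 * 'rV[R]_2 -> R.
Hypotheses (sf : smooth_on (slit_over D) f) (hf : homogeneous1 D f).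

(** The Hessian on arbitrary directions, as the square of the linear form v |-> q v_0 - p v_1; a
    change of coordinates sends the basis to such directions. *)
Lemma fiber_hessian_quadratic z (u v : 'rV[R]_2) : slit_over D z ->
  'D_(0, u) ('D_(0, v) f) z = lam f z *
    ((z.2 0 1 * u 0 0 - z.2 0 0 * u 0 1) * (z.2 0 1 * v 0 0 - z.2 0 0 * v 0 1)).
Proof.
move=> Uz; have oU := slit_over_open oD.
have d i : differentiable (pdxi i f) z by exact: smooth_diff (smooth_pdxi i sf) Uz.
have -> : 'D_(0, u) ('D_(0, v) f) z =
    'D_(0, u) (fun z => v 0 0 *: pdxi 0 f z + v 0 1 *: pdxi 1 f z) z.
  apply: near_eq_derive; apply: filterS (open_nbhs_nbhs (conj oU Uz)) => w Uw.
  by rewrite derive_fiber2//; exact: smooth_diff sf Uw.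
have dd i : derivable (pdxi i f) z (0, u) by exact: diff_derivable.
have [h00 h01 h10 h11] := hessE oD sf hf Uz.
have h i : 'D_(0, u) (pdxi i f) z =
    u 0 0 * pdxi 0 (pdxi i f) z + u 0 1 * pdxi 1 (pdxi i f) z.
  exact: derive_fiber2.
have e := deriveD (derivableZ (k := v 0 0) (dd 0)) (derivableZ (k := v 0 1) (dd 1)).
rewrite (deriveZ (v 0 0) (dd 0)) (deriveZ (v 0 1) (dd 1)) in e.
rewrite -[LHS]/('D_(0, u) (v 0 0 \*: pdxi 0 f + v 0 1 \*: pdxi 1 f) z) e !h h00 h01 h10 h11.
by rewrite -![_ *: _]/(_ * _); ring.
Qed.

Lemma tor_homogeneous z a : slit_over D z -> 0 < a ->
  tor f (z.1, a *: z.2) = tor f z.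
Proof.
move=> Uz a0.
have key i j : pdx j (pdxi i f) (z.1, a *: z.2) = pdx j (pdxi i f) z.
  have di w : slit_over D w -> differentiable (pdxi i f) w.
    exact/smooth_diff/smooth_pdxi.
  have dh w : slit_over D w -> pdxi i f (w.1, a *: w.2) = 1 * pdxi i f w.
    by move=> Uw; rewrite mul1r (dxi_homogeneous oD sf hf).
  have := derive_homogeneous oD (delta_mx 0 j) 0 a0 Uz di dh.
  by rewrite scaler0 mul1r !derive_base_delta.
by rewrite /tor !key.
Qed.

(** Degree -3: two fiber derivatives bring degree 1 down to -1, and the division by p^2 + q^2 takes
    off two more. *)
Lemma lam_homogeneous z a : slit_over D z -> 0 < a ->
  a ^+ 3 * lam f (z.1, a *: z.2) = lam f z.
Proof.
move=> Uz a0; have an0 : a != 0 by rewrite gt_eqF.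
have n0 := fiber_norm_neq0 Uz; have n1 := fiber_norm_neq0 (slit_over_scale Uz a0).
rewrite /lam -(hess_trace_homogeneous oD sf hf Uz a0) /= !mxE.
rewrite /= !mxE in n1; move: (hess_trace _ _) n0 n1 => T n0 n1.
by field; rewrite n1 n0.
Qed.

End HomogeneousFactors.

(** * The pointwise content of projective equivalence *)

Section Proportionality.
Variables (R : realType) (S : manifold R 2) (F G : tangent S -> R).
Hypotheses (hF : finsler_metric F) (hG : finsler_metric G).
Hypothesis hFG : projectively_equivalent F G.
Implicit Types (phi psi : chart R 2 S).

(** The reparametrized geodesic has velocity a xi and acceleration a^2 w + s'' xi, where a = s' > 0.
    The s'' term drops out of the skew expression q w_0 - p w_1, which is thus multiplied by a^3;
    this cancels the degree -3 of [lam], while [tor] has degree 0. Both scalar equations then hold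
    with the same xi and [w], and eliminating q w_0 - p w_1 gives the claim. *)
Lemma tor_lam_proportional phi z : atlas phi -> slit_over (cimg phi) z ->
  tor (local F phi) z * lam (local G phi) z = tor (local G phi) z * lam (local F phi) z.
Proof.
move=> aphi Uz; have oD := @open_cimg R 2 S phi.
have [J [c [gc J0 hc0 lz]]] := geodesic_exists hF aphi Uz.
have [J' [s [[oJ' _] ss sJ sp gcs]]] := hFG gc.
have [t0 Jt0 st0] : (s @` J') 0 by rewrite sJ.
have h0 : chart_at ((c \o s) t0) phi by rewrite /= st0.
have h2 := geodesic_scalar hG gcs Jt0 h0; have h1 := geodesic_scalar hF gc J0 hc0.
cbv zeta in h1, h2; rewrite lz in h1.
set w := chart_accel phi c 0 in h1; set w' := chart_accel phi (c \o s) t0 in h2.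
pose a := 'D_1 s t0; have a0 : 0 < a by have := sp _ Jt0; rewrite derive1E.
pose X := cmap phi \o c.
pose J1 := J `&` c @^-1` cdom phi.
have oJ1 : open J1 := geodesic_chart_open (phi := phi) gc.
have sX : smooth_on J1 X by case: gc => _ [_ h] _ _; exact: h.
have J10 : J1 0 by split=> //; case: hc0.
have ds t : J' t -> is_derive t 1 s ('D_1 s t).
  by move=> Jt; split=> //; exact/derivable1_diffP/(smooth_diff ss Jt).
have scale (f : R -> 'rV[R]_2) t : J' t -> differentiable f (s t) ->
    is_derive t 1 (f \o s) ('D_1 s t *: 'D_1 f (s t)).
  move=> Jt df; have := is_derive_comp (ds t Jt) df.
  have e : 'D_('D_1 s t *: (1 : R)) f (s t) = 'D_1 s t *: 'D_1 f (s t).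
    exact: deriveZdir.
  have eb : 'D_1 s t *: (1 : R) = 'D_1 s t by exact: mulr1.
  by rewrite eb in e; rewrite e.
have zE : z = (X 0, 'D_1 X 0) by rewrite -lz lift_coordsE.
have near1 : \forall t \near t0, J' t /\ J1 (s t).
  have sc : {for t0, continuous s} := smooth_continuous ss Jt0.
  apply: filterI; first exact: (open_nbhs_nbhs (conj oJ' Jt0)).
  by apply: (sc J1); rewrite st0; exact: (open_nbhs_nbhs (conj oJ1 J10)).
have v1 t : J' t -> J1 (s t) -> 'D_1 (X \o s) t = 'D_1 s t *: 'D_1 X (s t).
  by move=> Jt Jst; have [] := scale X t Jt (smooth_diff sX Jst).
have z'E : lift_coords phi (c \o s) t0 = (z.1, a *: z.2).
  rewrite lift_coordsE zE /=; apply: injective_projections => /=; first by rewrite st0.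
  by have := v1 t0 Jt0; rewrite st0 => /(_ J10); rewrite -/a => <-.
have dX1 : differentiable ('D_1 X) (s t0).
  by rewrite st0; exact: smooth_diff (smooth_derive (1 : R) sX) J10.
have w'E : w' = 'D_1 ('D_1 s) t0 *: z.2 + a *: (a *: w).
  have [d3 e3] := scale ('D_1 X) t0 Jt0 dX1.
  have da : differentiable ('D_1 s) t0 := smooth_diff (smooth_derive (1 : R) ss) Jt0.
  rewrite st0 in e3.
  have dc : differentiable ('D_1 X \o s) t0 by exact/derivable1_diffP.
  have e4 := derive_scale (1 : R) da dc.
  have e5 : ('D_1 X \o s) t0 = 'D_1 X 0 by rewrite /= st0.
  rewrite e5 in e4.
  rewrite zE /= -[w]/('D_1 ('D_1 X) 0) -e3 -/a /=.
  transitivity ('D_1 (fun t => 'D_1 s t *: ('D_1 X \o s) t) t0).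
    by apply: near_eq_derive; apply: filterS near1 => t [Jt Jst]; exact: v1.
  exact: e4.
rewrite z'E /= (tor_homogeneous oD (finsler_smooth hG aphi) (finsler_homogeneous1 hG aphi) Uz a0) in h2.
rewrite -(lam_homogeneous oD (finsler_smooth hG aphi) (finsler_homogeneous1 hG aphi) Uz a0).
rewrite w'E !mxE in h2; move: h1 h2.
move: (lam _ (z.1, _)) (lam _ z) (tor _ z) (tor _ z) => lg lf tg tf.
move: (z.2 0 0) (z.2 0 1) (w 0 0) (w 0 1) ('D_1 ('D_1 s) t0) => p q w0 w1 b h1 h2.
transitivity (- lf * (q * w0 - p * w1) * (a ^+ 3 * lg)).
  apply/eqP; rewrite -subr_eq0; apply/eqP; transitivity ((tf + lf * (q * w0 - p * w1)) * (a ^+ 3 * lg)); first by ring.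
  by rewrite h1 mul0r.
apply/eqP; rewrite eq_sym -subr_eq0; apply/eqP.
transitivity ((tg + lg * (a * q * (b * p + a * (a * w0)) - a * p * (b * q + a * (a * w1)))) * lf).
  by ring.
by rewrite h2 mul0r.
Qed.

End Proportionality.

(** * Independence of the chart *)

Section Invariance.
Variables (R : realType) (S : manifold R 2).
Implicit Types (phi psi : chart R 2 S).

Lemma hessian_traceE (F : tangent S -> R) phi z :
  hessian_trace F phi z = hess_trace (local F phi) z.
Proof. by rewrite /hessian_trace /hess_trace pdxiE. Qed.

(** Second fiber derivatives along a basis vector become the Hessian in [psi] on its image under the
    differential of the transition, a square [m i ^+ 2] times [lam]. The factor in front depends on
    the charts and the vector alone, so it cancels in the ratio of two metrics. *)
Lemma hess_trace_transition (F : tangent S -> R) phi psi x xi :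
  finsler_metric F -> atlas phi -> atlas psi -> overlap phi psi x -> xi != 0 ->
  let z := tangent_map (transition phi psi) (x, xi) in
  let m i := z.2 0 1 * ('d (transition phi psi) x (delta_mx 0 i)) 0 0 -
             z.2 0 0 * ('d (transition phi psi) x (delta_mx 0 i)) 0 1 in
  hess_trace (local F phi) (x, xi) = (m 0 ^+ 2 + m 1 ^+ 2) * lam (local F psi) z.
Proof.
move=> hF aphi apsi xo xi0 z m.
pose T := transition phi psi.
pose B : {linear 'rV[R]_2 -> 'rV[R]_2} := 'd T x.
have sf := finsler_smooth hF aphi; have sg := finsler_smooth hF apsi.
have oE := @open_cimg R 2 S psi.
have Ux eta : eta != 0 -> slit_over (cimg phi) (x, eta).
  by move=> eta0; split=> //=; exact: overlap_cimg xo.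
have UT eta : eta != 0 -> slit_over (cimg psi) (T x, B eta).
  by move=> eta0; exact: (slit_transition aphi apsi (conj xo eta0)).
have first_derivative v eta : eta != 0 ->
    'D_(0, v) (local F phi) (x, eta) = 'D_(0, B v) (local F psi) (T x, B eta).
  move=> eta0; apply: derive_fiber_linear => //.
  - exact: smooth_diff sf (Ux _ eta0).
  - exact: smooth_diff sg (UT _ eta0).
  - by move=> eta' _; exact: local_transition.
have second_derivative i :
    pdxi i (pdxi i (local F phi)) (x, xi) = m i ^+ 2 * lam (local F psi) z.
  have d1 : differentiable (pdxi i (local F phi)) (x, xi).
    by apply: (smooth_diff _ (Ux _ xi0)); exact: smooth_pdxi.
  have d2 : differentiable ('D_(0, B (delta_mx 0 i)) (local F psi)) (T x, B xi).
    by apply: (smooth_diff _ (UT _ xi0)); exact: smooth_derive.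
  have E := derive_fiber_linear (delta_mx 0 i) d1 d2 _ xi0.
  rewrite -derive_fiber_delta E; last first.
    by move=> eta eta0; rewrite -derive_fiber_delta first_derivative.
  rewrite (fiber_hessian_quadratic oE sg (finsler_homogeneous1 hF apsi) _ _ (UT _ xi0)).
  by rewrite mulrC.
by rewrite /hess_trace !second_derivative mulrDl.
Qed.

Lemma tcoords_transition (v : tangent S) phi psi :
  chart_at (tbase v) phi -> chart_at (tbase v) psi ->
  tcoords psi v = tangent_map (transition phi psi) (tcoords phi v).
Proof.
move=> hphi hpsi; apply: injective_projections => /=.
  by rewrite /transition /= cmapK//; case: hphi.
exact: tcomp_law.
Qed.

Lemma hess_ratio_chart_independent (F G : tangent S -> R) (v : tangent S) phi psi :
  finsler_metric F -> finsler_metric G -> nonzero v ->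
  chart_at (tbase v) phi -> chart_at (tbase v) psi ->
  hess_ratio (local F phi) (local G phi) (tcoords phi v) =
  hess_ratio (local F psi) (local G psi) (tcoords psi v).
Proof.
move=> hF hG v0 hphi hpsi.
have xo : overlap phi psi (tcoords phi v).1.
  by exists (tbase v) => //; split; [case: hphi|case: hpsi].
have xi0 : (tcoords phi v).2 != 0 by exact: v0.
have Upsi := slit_tcoords v0 hpsi; have Uphi := slit_tcoords v0 hphi.
have lG := lam_local_gt0 hG hpsi.1 Upsi.
have tG : hess_trace (local G phi) (tcoords phi v) != 0.
  by apply: (hess_trace_neq0 Uphi); rewrite gt_eqF// lam_local_gt0//; case: hphi.
have oE := @open_cimg R 2 S psi.
have lG0 w : slit_over (cimg psi) w -> lam (local G psi) w != 0.
  by move=> Uw; rewrite gt_eqF// lam_local_gt0//; case: hpsi.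
have eF := hess_trace_transition hF hphi.1 hpsi.1 xo xi0.
have eG := hess_trace_transition hG hphi.1 hpsi.1 xo xi0.
rewrite (hess_ratioE _ lG0 Upsi).
rewrite /hess_ratio; rewrite (surjective_pairing (tcoords phi v)) in tG *.
cbv zeta in eF, eG; rewrite eG in tG; rewrite eF eG.
rewrite (tcoords_transition hphi hpsi) -surjective_pairing in lG tG *.
(* The common factor is nonzero because it divides the nonzero trace of [G]. *)
by rewrite -mulf_div divff ?mul1r//; move: tG; rewrite mulf_eq0 negb_or => /andP[].
Qed.

End Invariance.

(** * Constancy along the integral curves of both sprays *)

Section Constancy.
Variables (R : realType) (S : manifold R 2) (F G : tangent S -> R).
Hypotheses (hF : finsler_metric F) (hG : finsler_metric G).
Hypothesis hFG : projectively_equivalent F G.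

Lemma derive_hess_ratio_geodesic J c phi (t : R) :
  geodesic F J c \/ geodesic G J c -> J t -> chart_at (c t) phi ->
  is_derive t 1 (fun s => hess_ratio (local F phi) (local G phi) (lift_coords phi c s)) 0.
Proof.
move=> gc Jt h; have aphi := h.1; have oE := @open_cimg R 2 S phi.
set z := lift_coords phi c t; set w := chart_accel phi c t.
have Uz : slit_over (cimg phi) z by case: gc => gc; exact: geodesic_slit gc Jt h.
have dz : is_derive t 1 (lift_coords phi c) (z.2, w).
  by case: gc => gc; exact: geodesic_is_derive_lift gc Jt h.
have lF x : slit_over (cimg phi) x -> lam (local F phi) x != 0.
  by move=> Ux; rewrite gt_eqF// lam_local_gt0.
have lG x : slit_over (cimg phi) x -> lam (local G phi) x != 0.
  by move=> Ux; rewrite gt_eqF// lam_local_gt0.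
have prop x : slit_over (cimg phi) x -> tor (local F phi) x * lam (local G phi) x =
    tor (local G phi) x * lam (local F phi) x by exact: tor_lam_proportional.
have sF := finsler_smooth hF aphi; have sG := finsler_smooth hG aphi.
have hF1 := finsler_homogeneous1 hF aphi; have hG1 := finsler_homogeneous1 hG aphi.
(* A geodesic of [F] also satisfies the scalar equation of [G]: multiplied by [lam] of [F], it
   becomes [lam] of [G] times the equation of [F], by proportionality. *)
have K : tor (local G phi) z + lam (local G phi) z *
    (z.2 0 1 * w 0 0 - z.2 0 0 * w 0 1) = 0.
  case: gc => gc; last exact: (geodesic_scalar hG gc Jt h).
  have KF := geodesic_scalar hF gc Jt h; cbv zeta in KF; rewrite -/z -/w in KF.
  apply: (mulIf (lF z Uz)); rewrite mul0r mulrDl -prop//.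
  by rewrite mulrAC [lam (local G phi) z * _]mulrC mulrAC -mulrDl addrC [_ + tor _ _]addrC KF mul0r.
have d := differentiable_hess_ratio oE sF sG lG Uz.
have := is_derive_comp dz d.
by rewrite (derive_hess_ratio oE sF hF1 sG hG1 lG prop Uz K).
Qed.

Lemma is_derive0_constant (J : set R) (u : R -> R) : is_interval J ->
  (forall t : R, J t -> is_derive t 1 u 0) -> forall s t, J s -> J t -> u s = u t.
Proof.
move=> iJ du.
suff main s t : s < t -> J s -> J t -> u s = u t.
  move=> s t Js Jt; have [st|ts|->//] := ltgtP s t; first exact: main.
  by symmetry; exact: main.
move=> st Js Jt.
have inJ r : s <= r <= t -> J r by exact: iJ Js Jt r.
have [||r _] := @MVT R u (fun=> 0) s t st.
- move=> r /[!in_itv]/= /andP[/ltW sr /ltW rt]; apply: du; apply: inJ; by rewrite sr.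
- apply: derivable_within_continuous => r /[!in_itv]/= rI.
  by have [] := du r (inJ r rI).
by rewrite mul0r => /eqP; rewrite subr_eq0 => /eqP.
Qed.

(** Integral curves of the spray are velocity curves of geodesics. Near each time one chart suffices
    to show that the derivative of [I] along the curve vanishes; as [I] has the same expression in
    all charts, this holds on the whole interval. *)
Lemma hess_ratio_constant (I : tangent S -> R)
    (HI : forall (v : tangent S) (phi : chart R 2 S),
      nonzero v -> chart_at (tbase v) phi ->
      I v = hess_ratio (local F phi) (local G phi) (tcoords phi v)) X :
  geodesic_spray F X \/ geodesic_spray G X -> constant_along X I.
Proof.
move=> hX J gam oiJ ig.
have [c gc vl] : exists2 c, geodesic F J c \/ geodesic G J c & velocity_lift J c gam.
  case: hX => -[_ /(_ J gam oiJ)[/(_ ig)[c gc vl] _]]; exists c => //; [by left|by right].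
apply: (@is_derive0_constant J (I \o gam)); first by case: oiJ.
move=> t Jt; have oJ := oiJ.1.
have [phi aphi cphi] := atlas_cover (c t).
have h : chart_at (c t) phi by [].
have := derive_hess_ratio_geodesic gc Jt h; apply: near_eq_is_derive.
have cc : {for t, continuous c} by case: gc => -[_ [cc _] _ _]; exact: cc.
have n1 : \forall s \near t, J s /\ cdom phi (c s).
  apply: filterI; first exact: (open_nbhs_nbhs (conj oJ Jt)).
  by apply: (cc (cdom phi)); exact: (open_nbhs_nbhs (conj (cdom_open phi) cphi)).
apply: filterS n1 => s [Js cs].
have [bs lsE] := vl s Js; have [nz _ _] := ig s Js.
rewrite /= (HI (gam s) phi nz); last by rewrite bs.
by rewrite lsE.
Qed.

End Constancy.

Unset Implicit Arguments.

Theorem mainTheorem2 (R : realType) (S : manifold R 2)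
    (Fhat Fcheck : tangent S -> R)
    (hhat : finsler_metric Fhat)
    (hcheck : finsler_metric Fcheck)
    (hproj : projectively_equivalent Fhat Fcheck) :
  (forall (v : tangent S) (phi : chart R 2 S),
      nonzero v -> chart_at (tbase v) phi ->
      hessian_trace Fcheck phi (tcoords phi v) <> 0 /\
      forall i j : 'I_2,
        dxi j (dxi i (local Fhat phi)) (tcoords phi v) =
        hessian_factor Fhat Fcheck phi (tcoords phi v) *
        dxi j (dxi i (local Fcheck phi)) (tcoords phi v)) /\
  exists I : tangent S -> R,
    (forall (v : tangent S) (phi : chart R 2 S),
        nonzero v -> chart_at (tbase v) phi ->
        I v = hessian_factor Fhat Fcheck phi (tcoords phi v)) /\
    (forall X, geodesic_spray Fhat X -> constant_along X I) /\
    (forall X, geodesic_spray Fcheck X -> constant_along X I).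
Proof.
have ratioE phi z : hessian_factor Fhat Fcheck phi z =
    hess_ratio (local Fhat phi) (local Fcheck phi) z.
  by rewrite /hessian_factor !hessian_traceE.
split.
  move=> v phi v0 h; have aphi := h.1; have oE := @open_cimg R 2 S phi.
  have Uz := slit_tcoords v0 h; set z := tcoords phi v in Uz *.
  have lG w : slit_over (cimg phi) w -> lam (local Fcheck phi) w != 0.
    by move=> Uw; rewrite gt_eqF// lam_local_gt0.
  split; first by rewrite hessian_traceE; exact/eqP/(hess_trace_neq0 Uz (lG z Uz)).
  move=> i j; rewrite ratioE (hess_ratioE _ lG Uz) -pdxiE.
  have [f00 f01 f10 f11] := hessE oE (finsler_smooth hhat aphi) (finsler_homogeneous1 hhat aphi) Uz.
  have [g00 g01 g10 g11] := hessE oE (finsler_smooth hcheck aphi) (finsler_homogeneous1 hcheck aphi) Uz.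
  have lz := lG z Uz.
  move: i j; apply: forall_ord2; apply: forall_ord2.
  - rewrite f00 g00; field; exact: lz.
  - rewrite f01 g01; field; exact: lz.
  - rewrite f10 g10; field; exact: lz.
  - rewrite f11 g11; field; exact: lz.
(* Some chart around the base point of each vector; on nonzero vectors [IE] frees the value of [I]
   from this choice, on zero vectors it is a mere default. *)
pose ch (v : tangent S) := s2val (cid2 (atlas_cover (tbase v))).
pose I (v : tangent S) := hessian_factor Fhat Fcheck (ch v) (tcoords (ch v) v).
have IE v phi : nonzero v -> chart_at (tbase v) phi ->
    I v = hess_ratio (local Fhat phi) (local Fcheck phi) (tcoords phi v).
  move=> v0 h; rewrite /I ratioE; apply: hess_ratio_chart_independent => //.
  by rewrite /ch; case: cid2.
exists I; split; first by move=> v phi v0 h; rewrite ratioE; exact: IE.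
by split=> X hX; apply: (hess_ratio_constant hhat hcheck hproj IE); [left|right].
Qed.
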